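(* Let $d\ge1$ and $\Lambda\ge0$. The C*-envelope and the propagation number of the operator system $\mathrm{C}(\mathbb{T}^d)^{(\Lambda)}$ are given by $\mathrm{C}^*_{\mathrm{env}}(\mathrm{C}(\mathbb{T}^d)^{(\Lambda)})=\mathcal{B}(P_\Lambda\mathcal{H})$ and $\mathrm{prop}(\mathrm{C}(\mathbb{T}^d)^{(\Lambda)})=2$.
   Context: Let $\mathbb{T}^d=\mathbb{R}^d/2\pi\mathbb{Z}^d$, let $e_n(x)=e^{in\cdot x}$ for $n\in\mathbb{Z}^d$, and let $\overline{\mathrm{B}}_\Lambda^{\mathbb{Z}}=\{n\in\mathbb{Z}^d:\|n\|\le\Lambda\}$ (Euclidean norm). Let $\mathcal{H}=\mathrm{L}^2(\mathbb{T}^d)\otimes V$ with $V=\mathbb{C}^{2^{\lfloor d/2\rfloor}}$, identified with the Hilbert space of $\mathrm{L}^2$-sections of the spinor bundle of $\mathbb{T}^d$; functions $f$ act on $\mathcal{H}$ by $f(g\otimes v)=(fg)\otimes v$. For $\Lambda\ge0$, $P_\Lambda$ is the orthogonal projection onto the span of the eigenspinors of the Dirac operator of $\mathbb{T}^d$ with eigenvalues of modulus at most $\Lambda$; concretely, $P_\Lambda\mathcal{H}=\mathrm{span}\{e_n:n\in\overline{\mathrm{B}}_\Lambda^{\mathbb{Z}}\}\otimes V$. The operator system is $\mathrm{C}(\mathbb{T}^d)^{(\Lambda)}=P_\Lambda\mathrm{C}^\infty(\mathbb{T}^d)P_\Lambda\subset\mathcal{B}(P_\Lambda\mathcal{H})$,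 with the matrix order structure inherited from $\mathcal{B}(P_\Lambda\mathcal{H})$. Its elements are of the form $T=(t_{k-l})_{k,l\in\overline{\mathrm{B}}_\Lambda^{\mathbb{Z}}}$ with $t_{k-l}=\langle e_k,Te_l\rangle$, acting by $T\big(\sum_k a_ke_k\otimes v\big)=\sum_k\sum_l t_{k-l}a_l\,e_k\otimes v$ (sums over $\overline{\mathrm{B}}_\Lambda^{\mathbb{Z}}$). A C*-extension of a unital operator system $E$ is a unital C*-algebra $A$ together with an injective completely positive map $\iota:E\to A$ such that $\mathrm{C}^*(\iota(E))=A$. A C*-extension $A$ of $E$ is called the C*-envelope, denoted $\mathrm{C}^*_{\mathrm{env}}(E)$, if for every unital C*-algebra $B$ and every unital completely positive map $\phi:A\to B$, the map $\phi$ is a complete order injection if the composition $\phi\circ\iota$ is. The propagation number $\mathrm{prop}(E)$ is the smallest positive integer $n$ such that $(\iota(E))^{\circ n}\subseteq\mathrm{C}^*_{\mathrm{env}}(E)$ is a C*-algebra, where $F^{\circ n}=\mathrm{span}\{f_1\cdots f_n:f_i\in F\}$ for a unital operator subsystem $F$ of a unital C*-algebra.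
   Formalization: For d ≥ 2 elements act as t⊗1_V, so the C*-envelope is B(P_Λ L²(T^d)), not B(P_Λ H); the literal claim is kept for d = 1. For Λ < 1 the system is C·1 with propagation number 1, so prop = 2 is stated for Λ ≥ 1 and prop = 1 for Λ < 1. *)

(* Defs.v *)
From HB Require Import structures.
From mathcomp Require Import all_boot all_order all_algebra.
From mathcomp Require Import spectral sesquilinear finmap.
From mathcomp.real_closed Require Import complex.
From mathcomp Require Import all_classical all_reals all_analysis.
Set Implicit Arguments.
Unset Strict Implicit.
Unset Printing Implicit Defensive.
Import Order.TTheory GRing.Theory Num.Theory numFieldNormedType.Exports.
Local Open Scope classical_set_scope.
Local Open Scope ring_scope.

(* Unital C*-algebras over R[i].  The library hierarchy lacks the join of
   PzSemiRing and SemiNormedZmodule that a normed-ring structure would need, so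
   the product [cmul] and the unit [cone] are fields here; [as_ring A] is the
   same carrier seen as a library ring.  The zero algebra is allowed. *)
HB.mixin Record isCStarAlgebra (R : realType) A
    of CompleteNormedModule R[i] A := {
  cmul : A -> A -> A;
  cone : A;
  star : A -> A;
  cmulA : associative cmul;
  cmul1l : left_id cone cmul;
  cmulr1 : right_id cone cmul;
  cmulDl : left_distributive cmul +%R;
  cmulDr : right_distributive cmul +%R;
  cmulZl : forall (a : R[i]) (x y : A), cmul (a *: x) y = a *: cmul x y;
  cmulZr : forall (a : R[i]) (x y : A), cmul x (a *: y) = a *: cmul x y;
  starD : forall x y : A, star (x + y) = star x + star y;
  starZ : forall (a : R[i]) (x : A), star (a *: x) = a^* *: star x;
  starM : forall x y : A, star (cmul x y) = cmul (star y) (star x);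
  starK : involutive star;
  cnormM : forall x y : A, `|cmul x y| <= `|x| * `|y|;
  cnorm_star : forall x : A, `|cmul (star x) x| = `|x| ^+ 2 }.

#[short(type="cstarAlgType")]
HB.structure Definition CStarAlgebra (R : realType) :=
  {A of CompleteNormedModule R[i] A & isCStarAlgebra R A}.

Definition as_ring (R : realType) (A : cstarAlgType R) : Type := A.

HB.instance Definition _ (R : realType) (A : cstarAlgType R) :=
  GRing.Zmodule.copy (as_ring A) A.
HB.instance Definition _ (R : realType) (A : cstarAlgType R) :=
  GRing.Zmodule_isPzRing.Build (as_ring A)
    (@cmulA R A) (@cmul1l R A) (@cmulr1 R A) (@cmulDl R A) (@cmulDr R A).

Section OperatorNorm.
Context (R : realType).
Local Notation C := R[i].
Local Open Scope sesquilinear_scope.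
Implicit Types (n : nat).

(* Euclidean norm on C^n, and the operator norm it induces. *)
Definition hnorm n (v : 'cV[C]_n) : R := Num.sqrt (\sum_i Normc.normc (v i 0) ^+ 2).

Definition opnorm n (T : 'M[C]_n) : R :=
  sup [set hnorm (T *m v) | v in [set v : 'cV[C]_n | hnorm v <= 1]].

Lemma normcR (z : C) : `|z| = (Normc.normc z)%:C%C.
Proof. by case: z. Qed.

Lemma normc_ge0 (z : C) : 0 <= Normc.normc z.
Proof. by case: z => a b; exact: sqrtr_ge0. Qed.

Lemma normc_conj (z : C) : Normc.normc z^* = Normc.normc z.
Proof. by apply: complexI; rewrite -!normcR norm_conjC. Qed.

Lemma hnorm_ge0 n (v : 'cV[C]_n) : 0 <= hnorm v.
Proof. exact: sqrtr_ge0. Qed.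

Lemma sqr_hnorm n (v : 'cV[C]_n) :
  (hnorm v ^+ 2)%:C%C = \sum_i v i 0 * (v i 0)^*.
Proof.
rewrite sqr_sqrtr; last by apply: sumr_ge0 => i _; rewrite sqr_ge0.
rewrite (raddf_sum (real_complex R)); apply: eq_bigr => i _.
by rewrite -normCK normcR -(rmorphXn (real_complex R)).
Qed.

Lemma hnorm_dotmx n (v : 'cV[C]_n) : (hnorm v)%:C%C = sqrtC (dotmx v^T v^T).
Proof.
have -> : dotmx v^T v^T = (hnorm v)%:C%C ^+ 2.
  rewrite dotmxE mxE -rmorphXn /= sqr_hnorm.
  by apply: eq_bigr => i _; rewrite !mxE.
by rewrite sqrCK // lecR hnorm_ge0.
Qed.

Lemma hnormD n (u v : 'cV[C]_n) : hnorm (u + v) <= hnorm u + hnorm v.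
Proof.
rewrite -lecR rmorphD /= !hnorm_dotmx linearD /=.
exact: (triangle_lerif (@dotmx C n) _ _).1.
Qed.

Lemma hnormZ n (a : C) (v : 'cV[C]_n) :
  hnorm (a *: v) = Normc.normc a * hnorm v.
Proof.
rewrite /hnorm -[X in _ = X * _]ger0_norm ?normc_ge0 // -sqrtr_sqr.
rewrite -sqrtrM ?sqr_ge0 // mulr_sumr; congr Num.sqrt.
by apply: eq_bigr => i _; rewrite mxE Normc.normcM exprMn.
Qed.

Lemma hnorm0_eq0 n (v : 'cV[C]_n) : hnorm v = 0 -> v = 0.
Proof.
move=> /eqP v0; apply/colP => i; rewrite mxE; apply/Normc.eq0_normc/eqP.
move: v0; rewrite sqrtr_eq0 => v0.
have: \sum_i Normc.normc (v i 0) ^+ 2 == 0.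
  by rewrite eq_le v0 sumr_ge0 // => j _; rewrite sqr_ge0.
rewrite psumr_eq0; last by move=> j _; rewrite sqr_ge0.
by move=> /allP/(_ i); rewrite mem_index_enum => /(_ isT); rewrite sqrf_eq0.
Qed.

Lemma hnorm0 n : hnorm (0 : 'cV[C]_n) = 0.
Proof. by rewrite -(scale0r 0) hnormZ Normc.normc0 mul0r. Qed.

Lemma hnorm_sum n (J : Type) (r : seq J) (F : J -> 'cV[C]_n) :
  hnorm (\sum_(j <- r) F j) <= \sum_(j <- r) hnorm (F j).
Proof.
elim/big_rec2: _ => [|j a b _ h]; first by rewrite hnorm0.
by rewrite (le_trans (hnormD _ _)) // lerD2l.
Qed.

Lemma hnorm_CS n (u v : 'cV[C]_n) :
  Normc.normc (\sum_i v i 0 * (u i 0)^*) <= hnorm u * hnorm v.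
Proof.
rewrite -lecR -normcR rmorphM /= !hnorm_dotmx mulrC.
suff -> : \sum_i v i 0 * (u i 0)^* = dotmx v^T u^T.
  exact: (CauchySchwarz_sqrt (@dotmx _ n) _ _).1.
by rewrite dotmxE mxE; apply: eq_bigr => i _; rewrite !mxE.
Qed.

Lemma normc_le_hnorm n (v : 'cV[C]_n) i : Normc.normc (v i 0) <= hnorm v.
Proof.
rewrite -[leLHS]ger0_norm ?normc_ge0 // -sqrtr_sqr ler_wsqrtr //.
rewrite [leRHS](bigD1 i) //= lerDl sumr_ge0 // => j _.
by rewrite sqr_ge0.
Qed.

Lemma hnorm_delta n (i : 'I_n) : hnorm (delta_mx i 0 : 'cV[C]_n) = 1.
Proof.
rewrite /hnorm (bigD1 i) //= !mxE !eqxx Normc.normc1 big1 => [|j ji].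
  by rewrite addr0 expr1n sqrtr1.
by rewrite !mxE (negbTE ji) Normc.normc0 expr0n.
Qed.

Lemma col_sum_delta n (v : 'cV[C]_n) : v = \sum_i v i 0 *: delta_mx i 0.
Proof.
rewrite [LHS]matrix_sum_delta; apply: eq_bigr => i _.
by rewrite big_ord_recl big_ord0 addr0; congr (v _ _ *: delta_mx _ _).
Qed.

Lemma hnorm_mulmx_le n (T : 'M[C]_n) (v : 'cV[C]_n) :
  hnorm (T *m v) <= (\sum_j hnorm (T *m delta_mx j 0)) * hnorm v.
Proof.
rewrite {1}[v]col_sum_delta mulmx_sumr (le_trans (hnorm_sum _ _)) // mulr_suml.
apply: ler_sum => j _; rewrite -scalemxAr hnormZ mulrC.
by rewrite ler_wpM2l ?hnorm_ge0 ?normc_le_hnorm.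
Qed.

Lemma opnorm_has_sup n (T : 'M[C]_n) :
  has_sup [set hnorm (T *m v) | v in [set v : 'cV[C]_n | hnorm v <= 1]].
Proof.
split; first by exists (hnorm (T *m 0)), 0; rewrite //= hnorm0.
exists (\sum_j hnorm (T *m delta_mx j 0)) => _ [v /= v1 <-].
rewrite (le_trans (hnorm_mulmx_le _ _)) // ler_piMr // sumr_ge0 // => j _.
exact: hnorm_ge0.
Qed.

Lemma opnorm_ge0 n (T : 'M[C]_n) : 0 <= opnorm T.
Proof.
have -> : 0 = hnorm (T *m 0) by rewrite mulmx0 hnorm0.
apply: sup_upper_bound; first exact: opnorm_has_sup.
by exists 0 => //=; rewrite hnorm0.
Qed.

Lemma hnorm_mulmx n (T : 'M[C]_n) (v : 'cV[C]_n) :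
  hnorm (T *m v) <= opnorm T * hnorm v.
Proof.
have [v0|v_neq0] := eqVneq (hnorm v) 0.
  by rewrite (hnorm0_eq0 v0) mulmx0 hnorm0 mulr0.
have v_gt0 : 0 < hnorm v by rewrite lt_def v_neq0 hnorm_ge0.
have normV : Normc.normc ((hnorm v)^-1)%:C%C = (hnorm v)^-1.
  by apply: complexI; rewrite -normcR ger0_norm // ler0c invr_ge0 ltW.
rewrite -ler_pdivrMr // mulrC -{1}normV -hnormZ scalemxAr.
apply: sup_upper_bound; first exact: opnorm_has_sup.
by exists (((hnorm v)^-1)%:C%C *: v) => //=; rewrite hnormZ normV mulVf.
Qed.

Lemma opnorm_le n (T : 'M[C]_n) (c : R) : 0 <= c ->
  (forall v, hnorm (T *m v) <= c * hnorm v) -> opnorm T <= c.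
Proof.
move=> c0 Tc; apply: ge_sup; first exact: (opnorm_has_sup T).1.
by move=> _ [v /= v1 <-]; rewrite (le_trans (Tc v)) // ler_piMr.
Qed.

Lemma opnormD n (S T : 'M[C]_n) : opnorm (S + T) <= opnorm S + opnorm T.
Proof.
apply: opnorm_le => [|v]; first by rewrite addr_ge0 ?opnorm_ge0.
by rewrite mulmxDl mulrDl (le_trans (hnormD _ _)) // lerD ?hnorm_mulmx.
Qed.

Lemma opnormZ_le n (a : C) (T : 'M[C]_n) :
  opnorm (a *: T) <= Normc.normc a * opnorm T.
Proof.
apply: opnorm_le => [|v]; first by rewrite mulr_ge0 ?normc_ge0 ?opnorm_ge0.
by rewrite -scalemxAl hnormZ -mulrA ler_wpM2l ?normc_ge0 ?hnorm_mulmx.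
Qed.

Lemma opnormZ n (a : C) (T : 'M[C]_n) :
  opnorm (a *: T) = Normc.normc a * opnorm T.
Proof.
apply/eqP; rewrite eq_le opnormZ_le /=; have [->|a0] := eqVneq a 0.
  by rewrite Normc.normc0 mul0r opnorm_ge0.
have na : 0 < Normc.normc a.
  by rewrite -ltcR -normcR normr_gt0.
rewrite -ler_pdivlMl // -Normc.normcV -{1}[T](scalerK a0).
exact: opnormZ_le.
Qed.

Lemma normc_le_opnorm n (T : 'M[C]_n) i j : Normc.normc (T i j) <= opnorm T.
Proof.
have -> : T i j = col j T i 0 by rewrite mxE.
rewrite colE.
rewrite (le_trans (normc_le_hnorm _ _)) // (le_trans (hnorm_mulmx _ _)) //.
by rewrite hnorm_delta mulr1.
Qed.

Lemma opnorm_le_sum n (T : 'M[C]_n) :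
  opnorm T <= \sum_j \sum_i Normc.normc (T i j).
Proof.
apply: opnorm_le => [|v].
  by do 2![rewrite sumr_ge0 // => ? _]; rewrite normc_ge0.
rewrite (le_trans (hnorm_mulmx_le _ _)) // ler_wpM2r ?hnorm_ge0 //.
apply: ler_sum => j _; rewrite -colE {1}[col j T]col_sum_delta.
rewrite (le_trans (hnorm_sum _ _)) //; apply: ler_sum => i _.
by rewrite hnormZ hnorm_delta mulr1 mxE.
Qed.

Lemma opnorm0_eq0 n (T : 'M[C]_n) : opnorm T = 0 -> T = 0.
Proof.
move=> T0; apply/matrixP => i j; rewrite mxE; apply: Normc.eq0_normc.
by apply/eqP; rewrite eq_le normc_ge0 -[leRHS]T0 normc_le_opnorm.
Qed.

Lemma opnormM n (S T : 'M[C]_n) : opnorm (S *m T) <= opnorm S * opnorm T.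
Proof.
apply: opnorm_le => [|v]; first by rewrite mulr_ge0 ?opnorm_ge0.
rewrite -mulmxA (le_trans (hnorm_mulmx _ _)) // -mulrA.
by rewrite ler_wpM2l ?opnorm_ge0 ?hnorm_mulmx.
Qed.

Lemma mulmx_adjE n (u v : 'cV[C]_n) :
  (u^t* *m v) 0 0 = \sum_i v i 0 * (u i 0)^*.
Proof. by rewrite mxE; apply: eq_bigr => i _; rewrite !mxE mulrC. Qed.

Lemma sqr_opnorm_le n (T : 'M[C]_n) :
  opnorm T ^+ 2 <= opnorm (T^t* *m T).
Proof.
set c := opnorm (T^t* *m T).
have c0 : 0 <= c by exact: opnorm_ge0.
rewrite -[leRHS]sqr_sqrtr // ler_sqr ?nnegrE ?sqrtr_ge0 ?opnorm_ge0 //.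
apply: opnorm_le => [|v]; first exact: sqrtr_ge0.
rewrite -ler_sqr ?nnegrE ?mulr_ge0 ?sqrtr_ge0 ?hnorm_ge0 // exprMn [X in _ <= X * _]sqr_sqrtr //.
have adjE : \sum_i (T^t* *m T *m v) i 0 * (v i 0)^* = (hnorm (T *m v) ^+ 2)%:C%C.
  by rewrite sqr_hnorm -!mulmx_adjE trmx_mul map_mxM /= !mulmxA.
have <- : Normc.normc (\sum_i (T^t* *m T *m v) i 0 * (v i 0)^*) =
          hnorm (T *m v) ^+ 2.
  by apply: complexI; rewrite -normcR adjE ger0_norm // ler0c sqr_ge0.
rewrite (le_trans (hnorm_CS v _)) // mulrC expr2 mulrA.
by rewrite ler_wpM2r ?hnorm_ge0 // hnorm_mulmx.
Qed.

Lemma opnorm_star n (T : 'M[C]_n) : opnorm (T^t*) = opnorm T.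
Proof.
suff le_star (S : 'M[C]_n) : opnorm S <= opnorm (S^t*).
  by apply/eqP; rewrite eq_le le_star -{2}[T]trmxCK le_star.
have [->|S0] := eqVneq (opnorm S) 0; first exact: opnorm_ge0.
have S_gt0 : 0 < opnorm S by rewrite lt_def S0 opnorm_ge0.
rewrite -(ler_pM2r S_gt0) -expr2 (le_trans (sqr_opnorm_le _)) //.
exact: opnormM.
Qed.

Lemma opnorm_cstar n (T : 'M[C]_n) : opnorm (T^t* *m T) = opnorm T ^+ 2.
Proof.
apply/eqP; rewrite eq_le sqr_opnorm_le andbT.
by rewrite (le_trans (opnormM _ _)) // opnorm_star expr2.
Qed.

End OperatorNorm.

(* B(H) for a Hilbert space H with a finite orthonormal basis indexed by I:
   operators are matrices in that basis, with the operator norm and the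
   adjoint T^t* as involution. *)
Definition bop (R : realType) (I : finType) : Type := 'M[R[i]]_#|I|.

Section BoundedOperators.
Context (R : realType) (I : finType).
Local Notation C := R[i].
Local Open Scope sesquilinear_scope.
Local Notation B := (bop R I).

HB.instance Definition _ := GRing.Lmodule.copy B 'M[C]_#|I|.

Let norm (T : B) : C := (opnorm T)%:C%C.

Let normD (S T : B) : norm (S + T) <= norm S + norm T.
Proof. by rewrite /norm -rmorphD /= lecR opnormD. Qed.

Let normZ (a : C) (T : B) : norm (a *: T) = `|a| * norm T.
Proof. by rewrite /norm opnormZ rmorphM /= normcR. Qed.

Let norm_eq0 (T : B) : norm T = 0 -> T = 0.
Proof. by move=> /complexI /opnorm0_eq0. Qed.

HB.instance Definition _ := Lmodule_isNormed.Build C B normD normZ norm_eq0.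

Lemma bop_normE (T : B) : `|T| = (opnorm T)%:C%C.
Proof. by []. Qed.

Let entry_cauchy (f : C -> R) (F : set_system B) i j :
  (forall a b : C, `|f a - f b| <= Normc.normc (a - b)) ->
  ProperFilter F -> cauchy F -> cauchy ((fun T : B => f (T i j)) @ F).
Proof.
move=> f_le FF /cauchyP Fc; apply/cauchyP => e e0.
have [|T0 FT0] := Fc e%:C%C; first by rewrite ltcR.
exists (f (T0 i j)); change (F [set T : B | ball (f (T0 i j)) e (f (T i j))]).
apply: filterS FT0 => T.
rewrite -!ball_normE /ball_ /= bop_normE ltcR => T_lt.
rewrite (le_lt_trans (f_le _ _)) // (le_lt_trans _ T_lt) //.
by have := normc_le_opnorm (T0 - T : 'M[C]_#|I|) i j; rewrite !mxE.
Qed.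

Let normc_le_ReIm (z : C) :
  Normc.normc z <= `|complex.Re z| + `|complex.Im z|.
Proof.
case: z => a b /=.
rewrite -[leRHS]ger0_norm ?addr_ge0 // -sqrtr_sqr ler_wsqrtr //.
rewrite sqrrD !real_normK ?num_real // lerD2r lerDl.
by rewrite mulrn_wge0 // mulr_ge0.
Qed.

Let Re_le (a b : C) :
  `|complex.Re a - complex.Re b| <= Normc.normc (a - b).
Proof.
case: a b => [a1 a2] [b1 b2] /=; rewrite -sqrtr_sqr ler_wsqrtr //.
by rewrite lerDl sqr_ge0.
Qed.

Let Im_le (a b : C) :
  `|complex.Im a - complex.Im b| <= Normc.normc (a - b).
Proof.
case: a b => [a1 a2] [b1 b2] /=; rewrite -sqrtr_sqr ler_wsqrtr //.
by rewrite lerDr sqr_ge0.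
Qed.

Let bop_complete (F : set_system B) : ProperFilter F -> cauchy F -> cvg F.
Proof.
move=> FF Fc.
have cR i j := R_complete (fmap_proper_filter _ FF) (entry_cauchy i j Re_le FF Fc).
have cI i j := R_complete (fmap_proper_filter _ FF) (entry_cauchy i j Im_le FF Fc).
pose l i j := (lim ((fun T : B => complex.Re (T i j)) @ F) +i*
               lim ((fun T : B => complex.Im (T i j)) @ F))%C.
pose L : B := \matrix_(i, j) l i j.
apply/cvg_ex; exists L; apply/cvgrPdist_le => e e0.
have eE : e = (complex.Re e)%:C%C.
  by rewrite RRe_real // ger0_real // ltW.
have e'0 : 0 < complex.Re e by rewrite -ltcR -eE.
pose N : R := (2 * #|I| * #|I|).+1%:R.
have N0 : 0 < N by rewrite ltr0n.
pose dlt := complex.Re e / N.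
have d0 : 0 < dlt by rewrite divr_gt0.
have FR : \forall T \near F, forall i j : 'I_#|I|,
    `|complex.Re (L i j) - complex.Re ((T : B) i j)| <= dlt.
  apply: filter_forall => i; apply: filter_forall => j; rewrite mxE.
  by move/cvgrPdist_le: (cR i j); apply.
have FI : \forall T \near F, forall i j : 'I_#|I|,
    `|complex.Im (L i j) - complex.Im ((T : B) i j)| <= dlt.
  apply: filter_forall => i; apply: filter_forall => j; rewrite mxE.
  by move/cvgrPdist_le: (cI i j); apply.
apply: filterS2 FR FI => T TR TI.
rewrite bop_normE eE lecR (le_trans (opnorm_le_sum _)) //.
have -> : complex.Re e = dlt * N by rewrite divfK // gt_eqF.
apply: (@le_trans _ _ (\sum_(j < #|I|) \sum_(i < #|I|) (dlt + dlt))).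
  apply: ler_sum => j _; apply: ler_sum => i _.
  have -> : (L - T : B) i j = L i j - T i j by rewrite !mxE.
  rewrite (le_trans (normc_le_ReIm _)) // !raddfB /=.
  by rewrite lerD ?TR ?TI.
rewrite !sumr_const !card_ord -mulr2n -!mulrnA -[leLHS]mulr_natr.
by rewrite ler_pM2l // ler_nat mulnA.
Qed.

HB.instance Definition _ := Uniform_isComplete.Build B bop_complete.

Let starD (S T : B) : (S + T : 'M[C]_#|I|)^t* = S^t* + T^t*.
Proof. by rewrite linearD /= map_mxD. Qed.

Let starZ (a : C) (T : B) : (a *: T : 'M[C]_#|I|)^t* = a^* *: T^t*.
Proof. by rewrite linearZ /= map_mxZ. Qed.

Let starM (S T : 'M[C]_#|I|) : (S *m T)^t* = T^t* *m S^t*.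
Proof. by rewrite trmx_mul map_mxM. Qed.

Let normM (S T : B) : `|(S : 'M[C]_#|I|) *m T : B| <= `|S| * `|T|.
Proof. by rewrite !bop_normE -rmorphM /= lecR opnormM. Qed.

Let norm_star (T : B) : `|(T : 'M[C]_#|I|)^t* *m T : B| = `|T| ^+ 2.
Proof. by rewrite !bop_normE opnorm_cstar rmorphXn. Qed.

HB.instance Definition _ := isCStarAlgebra.Build R B
  (@mulmxA _ _ _ _ _) (@mul1mx _ _ _) (@mulmx1 _ _ _)
  (@mulmxDl _ _ _ _) (@mulmxDr _ _ _ _)
  (fun a S T => esym (scalemxAl a S T)) (fun a S T => esym (scalemxAr a S T))
  starD starZ starM (@trmxCK _ _ _) normM norm_star.

End BoundedOperators.

Section OperatorSystems.
Context (R : realType).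
Implicit Types (A B : cstarAlgType R).

Definition mxstar A n (X : 'M[as_ring A]_n) : 'M[as_ring A]_n :=
  map_mx (@star R A) X^T.

(* The positive cone of the C*-algebra M_n(A). *)
Definition mxpositive A n (X : 'M[as_ring A]_n) : Prop :=
  exists Y : 'M[as_ring A]_n, X = mxstar Y *m Y.

Definition operator_system A (E : set A) : Prop :=
  [/\ E cone,
      forall (a : R[i]) x y, E x -> E y -> E (a *: x + y)
    & forall x, E x -> E (star x)].

(* A map out of an operator system E contained in A0 is a function on A0 of
   which only the restriction to E matters; M_n(E) carries the order of
   M_n(A0). *)
Definition linear_on A B (E : set A) (f : A -> B) : Prop :=
  forall (a : R[i]) x y, E x -> E y -> f (a *: x + y) = a *: f x + f y.

Definition unital A B (f : A -> B) : Prop := f cone = cone.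

Definition completely_positive A B (E : set A) (f : A -> B) : Prop :=
  linear_on E f /\
  forall n (X : 'M[as_ring A]_n), (forall i j, E (X i j)) ->
    mxpositive X -> mxpositive (map_mx f X : 'M[as_ring B]_n).

Definition complete_order_injection A B (E : set A) (f : A -> B) : Prop :=
  [/\ completely_positive E f,
      forall x y, E x -> E y -> f x = f y -> x = y
    & forall n (X : 'M[as_ring A]_n), (forall i j, E (X i j)) ->
        mxpositive (map_mx f X : 'M[as_ring B]_n) -> mxpositive X].

Definition cstar_subalgebra A (F : set A) : Prop :=
  [/\ F 0,
      forall (a : R[i]) x y, F x -> F y -> F (a *: x + y),
      forall x y, F x -> F y -> F (cmul x y),
      forall x, F x -> F (star x)
    & closed F].

(* C*(S), the smallest norm-closed *-subalgebra containing S. *)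
Definition cstar_generated A (S : set A) : set A :=
  [set x | forall F, cstar_subalgebra F -> S `<=` F -> F x].

(* The embedding of a C*-extension is required to be a unital complete order
   injection, not merely injective and completely positive: for an embedding
   that is not a complete order injection no [phi \o iota] is one, and the
   condition in [cstar_envelope] would be void. *)
Definition cstar_extension A0 A (E : set A0) (iota : A0 -> A) : Prop :=
  [/\ operator_system E, unital iota, complete_order_injection E iota
    & cstar_generated (iota @` E) = setT].

Definition cstar_envelope A0 A (E : set A0) (iota : A0 -> A) : Prop :=
  cstar_extension E iota /\
  forall B (phi : A -> B), unital phi -> completely_positive setT phi ->
    complete_order_injection E (phi \o iota) ->
    complete_order_injection setT phi.

(* F^{o n}: the span of the n-fold products of elements of F. *)
Definition power_span A (F : set A) (n : nat) : set A :=
  [set x | exists (m : nat) (c : 'I_m -> R[i]) (f : 'I_m -> 'I_n -> as_ring A),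
     (forall j i, F (f j i)) /\
     x = \sum_(j < m) c j *: (\prod_(i < n) f j i : A)].

(* prop(E) = n, computed in a given C*-envelope (A, iota) of E; C*-envelopes
   are unique up to *-isomorphism over E, so the choice does not matter. *)
Definition propagation_number A0 A (E : set A0) (iota : A0 -> A) (n : nat) :
    Prop :=
  [/\ cstar_envelope E iota,
      (0 < n)%N,
      cstar_subalgebra (power_span (iota @` E) n)
    & forall m, (0 < m < n)%N ->
        ~ cstar_subalgebra (power_span (iota @` E) m)].

End OperatorSystems.

Section TorusFunctions.
Context (R : realType) (d : nat).
Local Notation C := R[i].

Definition iter_partial (s : seq 'I_d) (g : 'rV[R]_d -> R) : 'rV[R]_d -> R :=
  foldr (fun (i : 'I_d) (h : 'rV[R]_d -> R) x => 'D_('e_i) h x) g s.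

Definition smooth (g : 'rV[R]_d -> R) : Prop :=
  forall s : seq 'I_d, continuous (iter_partial s g) /\
    forall (i : 'I_d) x, derivable (iter_partial s g) x 'e_i.

(* C^oo(T^d), as 2 pi Z^d-periodic functions on R^d. *)
Definition torus_smooth (f : 'rV[R]_d -> C) : Prop :=
  [/\ forall (n : 'rV[int]_d) x, f (x + (2 * pi) *: map_mx intr n) = f x,
      smooth (fun x => complex.Re (f x))
    & smooth (fun x => complex.Im (f x))].

(* e_n(x) = exp(i n.x) *)
Definition expi (n : 'rV[int]_d) (x : 'rV[R]_d) : C :=
  let t := \sum_i (n 0 i)%:~R * x 0 i in (cos t +i* sin t)%C.

End TorusFunctions.

(* Integral over T^d for the normalized Haar measure (2 pi)^-d dx, for which
   the e_n are orthonormal, written as an iterated Lebesgue integral over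
   [0, 2 pi]; it is only applied to continuous functions. *)
Fixpoint torus_mean (R : realType) (d : nat) : ('rV[R]_d -> R) -> R :=
  match d return ('rV[R]_d -> R) -> R with
  | 0 => fun g => g 0
  | d'.+1 => fun g =>
      (2 * pi)^-1 * \int[lebesgue_measure]_(t in `[0, 2 * pi])
        torus_mean (fun x : 'rV[R]_d' => g (row_mx t%:M x : 'rV[R]_(1 + d')))
  end.

Section SpectralTruncation.
Context (R : realType) (d : nat) (Lambda : R).
Local Notation C := R[i].

Definition torus_meanC (g : 'rV[R]_d -> C) : C :=
  (torus_mean (fun x => complex.Re (g x)) +i*
   torus_mean (fun x => complex.Im (g x)))%C.

Definition spin_dim : nat := 2 ^ d./2.

(* Sections of the (trivial) spinor bundle: functions T^d -> V = C^spin_dim. *)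
Definition spinor : Type := 'rV[R]_d -> 'cV[C]_spin_dim.

Definition spinor_dot (u v : spinor) : C :=
  torus_meanC (fun x => \sum_a (u x a 0)^* * v x a 0).

Definition lattice_ball : {fset 'rV[int]_d} :=
  fset_set [set n : 'rV[int]_d |
    Num.sqrt (\sum_i (n 0 i)%:~R ^+ 2) <= Lambda].

Definition trunc_basis : finType := (lattice_ball * 'I_spin_dim)%type.

(* The orthonormal basis e_n (x) v_a of P_Lambda H, so that
   [bop R trunc_basis] is B(P_Lambda H) and [bop R lattice_ball] is
   B(P_Lambda L^2(T^d)). *)
Definition basis_spinor (p : trunc_basis) : spinor :=
  fun x => expi (val p.1) x *: delta_mx p.2 0.

(* P_Lambda f P_Lambda as an operator on P_Lambda H. *)
Definition compression (f : 'rV[R]_d -> C) : bop R trunc_basis :=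
  \matrix_(p, q) spinor_dot (basis_spinor (enum_val p))
                   (fun x => f x *: basis_spinor (enum_val q) x).

Definition trunc_system : set (bop R trunc_basis) :=
  [set T | exists2 f, torus_smooth f & T = compression f].

Lemma spin_dim_gt0 : (0 < spin_dim)%N.
Proof. by rewrite expn_gt0. Qed.

(* Elements of [trunc_system] have the form t (x) 1_V with
   t = (<e_k, T e_l>)_{k,l}; this map sends T to t, reading <e_k, T e_l> as
   the entry of T at e_k (x) v_0, e_l (x) v_0. *)
Definition toeplitz (T : bop R trunc_basis) : bop R lattice_ball :=
  let e (k : 'I_#|{: lattice_ball}|) : trunc_basis :=
    (enum_val k, Ordinal spin_dim_gt0) in
  \matrix_(k, l) T (enum_rank (e k)) (enum_rank (e l)).

Lemma finite_lattice_ball : finite_set [set n : 'rV[int]_d |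
  Num.sqrt (\sum_i (n 0 i)%:~R ^+ 2) <= Lambda].
Proof.
pose M := Num.truncn Lambda.
pose h (g : {ffun 'I_d -> 'I_(2 * M).+1}) : 'rV[int]_d :=
  \row_i ((g i : nat)%:Z - M%:Z).
apply: (@sub_finite_set _ _ (range h)); last exact/finite_image/finite_finset.
move=> n /= n_le; exists [ffun i => inord `|n 0 i + M%:Z|] => //.
apply/rowP => i; rewrite mxE ffunE.
have ni : `|n 0 i| <= M%:Z.
  have : `|(n 0 i)%:~R| <= Lambda :> R.
    rewrite (le_trans _ n_le) // -sqrtr_sqr ler_wsqrtr //.
    by rewrite [leRHS](bigD1 i) //= lerDl sumr_ge0 // => j _; rewrite sqr_ge0.
  rewrite -intr_norm -(abszE (n 0 i)) -pmulrn => h1.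
  by rewrite lez_nat truncn_ge_nat // (le_trans _ h1).
have [lo hi] : - M%:Z <= n 0 i /\ n 0 i <= M%:Z.
  by move: ni; rewrite ler_norml => /andP.
have pos : 0 <= n 0 i + M%:Z by rewrite -lerBlDr sub0r.
rewrite inordK ?gez0_abs ?addrK // ltnS -lez_nat gez0_abs //.
by rewrite mul2n -addnn PoszD lerD2r.
Qed.

Lemma in_lattice_ball (n : 'rV[int]_d) :
  (n \in lattice_ball) = (Num.sqrt (\sum_i (n 0 i)%:~R ^+ 2) <= Lambda).
Proof.
rewrite /lattice_ball in_fset_set; last exact: finite_lattice_ball.
by apply/idP/idP; rewrite inE.
Qed.

End SpectralTruncation.

(* Main.v *)
Require Import Defs.
From mathcomp Require Import all_boot all_order all_algebra.
From mathcomp Require Import spectral sesquilinear finmap.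
From mathcomp.real_closed Require Import complex.
From mathcomp Require Import all_classical all_reals all_analysis.
From mathcomp Require Import zify ring.
Import Order.TTheory GRing.Theory Num.Theory numFieldNormedType.Exports.
Set Implicit Arguments.
Unset Strict Implicit.
Unset Printing Implicit Defensive.
Local Open Scope classical_set_scope.
Local Open Scope ring_scope.

(** Write N for the number of lattice points in the ball and A = M_N(C) for the
    operators on their span.  Up to the factor 1_V, the elements of the operator
    system are the matrices whose (k, l) entry depends only on the difference
    of the lattice points k and l ([trunc_systemP]): such a matrix is the
    compression of the trigonometric polynomial that has its entries as
    Fourier coefficients.

    An additive map Z^d -> Z that separates the finitely many differences of
    differences of lattice points turns these matrices into Toeplitz matrices
    over a finite set of integers c(k) ([difference_code]); the dimension d and
    the shape of the ball disappear from the problem.  [toep c] is this system.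

    C*-envelope ([toeplitz_rigidity]).  Let phi : A -> B be completely positive
    with phi restricted to [toep c] a complete order injection, and let
    X in M_n(A) be hermitian with phi(X) = Y^* Y.  To see that <u, X u> >= 0,
    compress X by the scalar matrix alpha with entries u_(i,j): this gives X'
    in M_N(A) with phi(X') again of the form Y'^* Y', and <u, X u> is the value
    <Omega, X' Omega> at the vector Omega = sum_i e_i (x) e_i.  The decisive
    object is a positive matrix L in M_N([toep c]) whose kernel is spanned by
    Omega ([shift_laplacian]).  Since L is bounded below away from Omega, for
    each eps > 0 some T = (<u, X u> + eps)/N + t L dominates X'.  Hence
    phi(T) = phi(X') + phi(T - X') is a sum of two squares, so T >= 0 because T
    has Toeplitz entries, and <Omega, T Omega> = <u, X u> + eps >= 0.  The
    argument uses of B only that sums of squares can be stacked into one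
    square of a larger matrix.

    Propagation number ([toep_square_full]).  The product of the shifts by
    c(k) - c(M) and c(M) - c(l), where c(M) is the largest value of c, is a sum
    of the matrix unit E_(k,l) and of matrix units E_(x,y) with
    c(y) < c(l).  By induction every matrix unit is a combination of products
    of two shifts, so two factors already give A.  One factor does not suffice
    as soon as there are two lattice points, because a shift times its adjoint
    is a proper diagonal projection and not Toeplitz
    ([toep_not_subalgebra]). *)

(** * Positive semidefinite complex matrices *)

Section PositiveMatrices.
Context (C : numClosedFieldType).
Local Open Scope sesquilinear_scope.

Definition qform n (M : 'M[C]_n) (v : 'cV[C]_n) : C := (v^t* *m M *m v) 0 0.

Definition psd n (M : 'M[C]_n) : Prop := forall v, 0 <= qform M v.

Lemma ctrmxM m n p (A : 'M[C]_(m, n)) (B : 'M[C]_(n, p)) :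
  (A *m B)^t* = B^t* *m A^t*.
Proof. by rewrite trmx_mul map_mxM. Qed.

Lemma ctrmxD m n (A B : 'M[C]_(m, n)) : (A + B)^t* = A^t* + B^t*.
Proof. by rewrite linearD /= map_mxD. Qed.

Lemma ctrmxZ m n a (A : 'M[C]_(m, n)) : (a *: A)^t* = a^* *: A^t*.
Proof. by rewrite linearZ /= map_mxZ. Qed.

Lemma qformE n (A : 'M[C]_n) v :
  qform A v = \sum_i \sum_j (v i 0)^* * A i j * v j 0.
Proof.
rewrite /qform mxE exchange_big; apply: eq_bigr => j _ /=.
by rewrite mxE mulr_suml; apply: eq_bigr => i _; rewrite !mxE.
Qed.

Lemma qformD n (A B : 'M[C]_n) v : qform (A + B) v = qform A v + qform B v.
Proof. by rewrite /qform mulmxDr mulmxDl mxE. Qed.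

Lemma qformZ n a (A : 'M[C]_n) v : qform (a *: A) v = a * qform A v.
Proof. by rewrite /qform -scalemxAr -scalemxAl mxE. Qed.

Lemma qformN n (A : 'M[C]_n) v : qform (- A) v = - qform A v.
Proof. by rewrite -scaleN1r qformZ mulN1r. Qed.

Lemma qform_adj n (A : 'M[C]_n) v : qform (A^t*) v = (qform A v)^*.
Proof.
rewrite /qform; have -> : v^t* *m A^t* *m v = (v^t* *m A *m v)^t*.
  by rewrite !ctrmxM trmxCK mulmxA.
by rewrite !mxE.
Qed.

Lemma qform_mul m n (M : 'M[C]_m) (Y : 'M[C]_(m, n)) v :
  qform (Y^t* *m M *m Y) v = qform M (Y *m v).
Proof. by rewrite /qform ctrmxM !mulmxA. Qed.

Lemma qform1 n (v : 'cV[C]_n) : qform 1%:M v = \sum_i `|v i 0| ^+ 2.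
Proof.
by rewrite /qform mulmx1 mxE; apply: eq_bigr => i _; rewrite !mxE mulrC -normCK.
Qed.

Lemma psd_gram m n (Y : 'M[C]_(m, n)) : psd (Y^t* *m Y).
Proof.
move=> v; rewrite -[Y^t*]mulmx1 qform_mul qform1.
by apply: sumr_ge0 => i _; rewrite exprn_ge0.
Qed.

Lemma qform_delta n (M : 'M[C]_n) i : qform M (delta_mx i 0) = M i i.
Proof. by rewrite /qform trmx_delta map_delta_mx -colE mxE -rowE mxE. Qed.

Lemma qformDZ n (M : 'M[C]_n) a (u v : 'cV[C]_n) :
  qform M (a *: u + v) = a^* * a * qform M u + a^* * (u^t* *m M *m v) 0 0 +
    a * (v^t* *m M *m u) 0 0 + qform M v.
Proof.
rewrite /qform ctrmxD ctrmxZ !mulmxDl !mulmxDr.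
rewrite -!(scalemxAl, scalemxAr) !scalerA.
have mxD (x y : 'M[C]_1) : (x + y) 0 0 = x 0 0 + y 0 0 by rewrite mxE.
have mxZ b (x : 'M[C]_1) : (b *: x) 0 0 = b * x 0 0 by rewrite mxE.
by rewrite !mxD !mxZ addrA.
Qed.

Lemma qform_delta2 n (M : 'M[C]_n) i j (c : C) :
  qform M (c *: delta_mx i 0 + delta_mx j 0) =
  c^* * c * M i i + c^* * M i j + c * M j i + M j j.
Proof.
have sesq k l :
    ((delta_mx k 0 : 'cV[C]_n)^t* *m M *m (delta_mx l 0 : 'cV_n)) 0 0 = M k l.
  by rewrite trmx_delta map_delta_mx -colE mxE -rowE mxE.
by rewrite qformDZ /qform !sesq.
Qed.

(** Polarization: over C the quadratic form determines the matrix. *)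
Lemma qform_eq0 n (M : 'M[C]_n) : (forall v, qform M v = 0) -> M = 0.
Proof.
move=> M0; have diag i : M i i = 0 by rewrite -qform_delta.
apply/matrixP => i j; rewrite mxE.
have := M0 (1 *: delta_mx i 0 + delta_mx j 0).
have := M0 ('i *: delta_mx i 0 + delta_mx j 0).
rewrite !qform_delta2 !diag conjC1 conjCi => e1 e2.
apply: (mulfI (_ : 2 * 'i != 0 :> C)); first by rewrite mulf_neq0 ?pnatr_eq0 ?neq0Ci.
have -> : 2 * 'i * M i j = 'i * (1 * 1 * 0 + 1 * M i j + 1 * M j i + 0) -
  (- 'i * 'i * 0 + - 'i * M i j + 'i * M j i + 0) by ring.
by rewrite e1 e2 !mulr0 subr0.
Qed.

Lemma psd_hermitian n (M : 'M[C]_n) : psd M -> M^t* = M.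
Proof.
move=> M_ge0; apply/eqP; rewrite -subr_eq0; apply/eqP/qform_eq0 => v.
by rewrite qformD qformN qform_adj (geC0_conj (M_ge0 v)) subrr.
Qed.

(** Used with z = 'i and z = - 'i, to test whether a matrix is hermitian by the
    positivity of two hermitian matrices. *)
Lemma skew_part_hermitian n (z : C) (M : 'M[C]_n) : z^* = - z ->
  (z *: (M - M^t*))^t* = z *: (M - M^t*).
Proof.
by move=> zN; apply/matrixP => i j; rewrite !mxE rmorphM rmorphB /= conjCK zN; ring.
Qed.

(** The square root is taken on the eigenvalues in the spectral theorem. *)
Lemma psd_sqrt n (M : 'M[C]_n) : psd M -> exists Y : 'M[C]_n, M = Y^t* *m Y.
Proof.
move=> M_ge0; have /psd_hermitian Mh := M_ge0.
have /orthomx_spectralP : M \is normalmx by apply/normalmxP; rewrite Mh.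
set P := spectralmx M; set d := spectral_diag M.
have Pu : P \is unitarymx by exact: spectral_unitarymx.
rewrite invmx_unitary // => eM.
have PPt : P *m P^t* = 1%:M by exact/unitarymxP.
have d_ge0 j : 0 <= d 0 j.
  have <- : qform M (P^t* *m delta_mx j 0) = d 0 j.
    rewrite -qform_mul trmxCK {1}eM -!mulmxA PPt mulmx1 mulmxA PPt mul1mx.
    by rewrite qform_delta !mxE eqxx.
  exact: M_ge0.
pose D := diag_mx (\row_j sqrtC (d 0 j)).
have Dh : D^t* = D.
  rewrite tr_diag_mx map_diag_mx; congr diag_mx; apply/rowP => j.
  by rewrite !mxE; apply: geC0_conj; rewrite sqrtC_ge0.
exists (D *m P); rewrite ctrmxM Dh -mulmxA [D *m _]mulmxA {1}eM mulmxA.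
congr (_ *m _ *m _); rewrite mulmx_diag; congr diag_mx; apply/rowP => j.
by rewrite !mxE -expr2 sqrtCK.
Qed.

Lemma psd_mxsub m n (f : 'I_m -> 'I_n) (M : 'M[C]_n) : psd M -> psd (mxsub f f M).
Proof.
move=> /psd_sqrt[Y ->].
have -> : mxsub f f (Y^t* *m Y) = (colsub f Y)^t* *m colsub f Y.
  by apply/matrixP => i j; rewrite !mxE; apply: eq_bigr => k _; rewrite !mxE.
exact: psd_gram.
Qed.

End PositiveMatrices.

(** * Dominating a hermitian form *)

Section Domination.
Context (C : numClosedFieldType).
Local Open Scope sesquilinear_scope.

Lemma normr_qform_le n (P : 'M[C]_n) (w : 'cV[C]_n) :
  `|qform P w| <= (\sum_i \sum_j `|P i j|) * \sum_i `|w i 0| ^+ 2.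
Proof.
set s := \sum_i `|w i 0| ^+ 2.
have s_ge0 : 0 <= s by apply: sumr_ge0 => i _; rewrite exprn_ge0.
have w_le i : `|w i 0| <= sqrtC s.
  rewrite -(@ler_pXn2r _ 2) ?nnegrE ?sqrtC_ge0 // sqrtCK [leRHS](bigD1 i) //=.
  by rewrite lerDl sumr_ge0 // => j _; rewrite exprn_ge0.
rewrite qformE (le_trans (ler_norm_sum _ _ _)) // mulr_suml.
apply: ler_sum => i _; rewrite (le_trans (ler_norm_sum _ _ _)) // mulr_suml.
apply: ler_sum => j _; rewrite !normrM norm_conjC mulrAC mulrC.
rewrite ler_wpM2l // -[s]sqrtCK expr2.
by rewrite ler_pM.
Qed.

Lemma qform_rank1 n (b : 'rV[C]_n) (w : 'cV[C]_n) :
  qform (b^t* *m b) w = `|(b *m w) 0 0| ^+ 2.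
Proof.
rewrite -[b^t*]mulmx1 qform_mul qform1 big_ord_recl big_ord0 addr0.
by [].
Qed.

(** A hermitian form P that is positive at o becomes positive semidefinite after
    adding a large multiple of the squared distance to the line of o, measured
    through the coordinate p0.  With x = a o + w and e = P(o), completing the
    square gives e P(x) = |e a + beta|^2 - |beta|^2 + e P(w), where beta is
    linear in w; the last two terms are bounded by multiples of |w|^2. *)
Lemma qform_dominate n (P : 'M[C]_n) (o : 'cV[C]_n) (p0 : 'I_n) :
  P^t* = P -> 0 < qform P o ->
  exists2 t : C, 0 <= t & forall x : 'cV[C]_n,
    0 <= qform P x + t * \sum_p `|x p 0 - x p0 0 * o p 0| ^+ 2.
Proof.
move=> Ph; set e := qform P o => e_gt0; have e_neq0 : e != 0 by rewrite gt_eqF.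
have er : e^* = e by rewrite geC0_conj // ltW.
pose b := o^t* *m P.
pose K (Q : 'M[C]_n) := \sum_i \sum_j `|Q i j|.
have K_ge0 Q : 0 <= K Q.
  by apply: sumr_ge0 => i _; apply: sumr_ge0 => j _.
exists (K (b^t* *m b) / e + K P).
  by rewrite addr_ge0 // mulr_ge0 // invr_ge0 ltW.
move=> x; set a := x p0 0; pose w := x - a *: o.
have -> : \sum_p `|x p 0 - a * o p 0| ^+ 2 = \sum_p `|w p 0| ^+ 2.
  by apply: eq_bigr => p _; rewrite !mxE.
set s := \sum_p _.
pose beta := (b *m w) 0 0.
have xE : qform P x = `|e * a + beta| ^+ 2 / e - `|beta| ^+ 2 / e + qform P w.
  have -> : x = a *: o + w by rewrite addrC subrK.
  have betaC : (w^t* *m P *m o) 0 0 = beta^*.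
    have -> : w^t* *m P *m o = (b *m w)^t* by rewrite /b !ctrmxM trmxCK Ph mulmxA.
    by rewrite 2!mxE.
  rewrite qformDZ betaC -/e -/b -/beta.
  rewrite !normCK rmorphD rmorphM /= er; field.
  exact: e_neq0.
have beta_le : `|beta| ^+ 2 <= K (b^t* *m b) * s.
  by rewrite -qform_rank1 (le_trans _ (normr_qform_le _ _)) // ger0_norm //; exact: psd_gram.
have Pw_real : qform P w \is Num.real.
  by apply/CrealP; rewrite -qform_adj Ph.
have Pw_ge : 0 <= qform P w + K P * s.
  rewrite addrC -lerBlDr sub0r (le_trans _ (normr_qform_le _ _)) //.
  by rewrite -normrN real_ler_norm // rpredN.
have -> : qform P x + (K (b^t* *m b) / e + K P) * s =
    `|e * a + beta| ^+ 2 / e + (K (b^t* *m b) * s - `|beta| ^+ 2) / e +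
    (qform P w + K P * s).
  by rewrite xE; ring.
have ei_ge0 : 0 <= e^-1 by rewrite invr_ge0 ltW.
apply: addr_ge0 => //; apply: addr_ge0; apply: mulr_ge0 => //.
by rewrite subr_ge0.
Qed.

(** The form is that of M - deg plus a graph Laplacian: each edge contributes
    |x_p - x_q|^2 = |x_p|^2 + |x_q|^2 - 2 Re (conj x_p x_q). *)
Lemma graph_form (T : finType) (r : rel T) (M : nat) (x : T -> C) :
    symmetric r ->
  2 * (M%:R * \sum_p `|x p| ^+ 2 - \sum_p \sum_(q | r p q) (x p)^* * x q) =
  \sum_p (2 * (M%:R - #|r p|%:R) * `|x p| ^+ 2 +
          \sum_(q | r p q) `|x p - x q| ^+ 2).
Proof.
move=> r_sym.
have sumq p : \sum_(q | r p q) `|x p - x q| ^+ 2 = #|r p|%:R * `|x p| ^+ 2 +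
    \sum_(q | r p q) `|x q| ^+ 2 - \sum_(q | r p q) (x p)^* * x q
    - \sum_(q | r p q) (x q)^* * x p.
  rewrite mulr_natl -sumr_const -big_split -!sumrB /=; apply: eq_bigr => q _.
  by rewrite !normCK rmorphB /=; ring.
have swap (F : T -> T -> C) :
    \sum_p \sum_(q | r p q) F q p = \sum_p \sum_(q | r p q) F p q.
  rewrite (exchange_big_dep xpredT) //=.
  by apply: eq_bigr => p _; apply: eq_bigl => q; rewrite r_sym.
have deg : \sum_p \sum_(q | r p q) `|x q| ^+ 2 =
           \sum_p #|r p|%:R * `|x p| ^+ 2.
  rewrite (swap (fun p q => `|x p| ^+ 2)); apply: eq_bigr => p _.
  by rewrite sumr_const mulr_natl.
have cross : \sum_p \sum_(q | r p q) (x q)^* * x p =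
    \sum_p \sum_(q | r p q) (x p)^* * x q.
  exact: (swap (fun p q => (x p)^* * x q)).
under [RHS]eq_bigr do rewrite sumq.
rewrite !big_split /= !sumrN deg cross.
have -> : \sum_p 2 * (M%:R - #|r p|%:R) * `|x p| ^+ 2 =
    2 * (M%:R * \sum_p `|x p| ^+ 2) - 2 * \sum_p #|r p|%:R * `|x p| ^+ 2.
  by rewrite !mulr_sumr -sumrB; apply: eq_bigr => p _; ring.
by ring.
Qed.

(** Where the degree is smaller than M the diagonal term bounds |x_p|^2; on D,
    the edge from p to p0 bounds |x_p - x_p0|^2. *)
Lemma graph_form_ge (T : finType) (r : rel T) (M : nat) (D : pred T) (p0 : T)
    (x : T -> C) :
    symmetric r -> (forall p, #|r p| <= M)%N -> (forall p, D p -> r p p0) ->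
    (forall p, ~~ D p -> #|r p| < M)%N ->
  \sum_p `|x p - x p0 * (D p)%:R| ^+ 2 <=
  2 * (M%:R * \sum_p `|x p| ^+ 2 - \sum_p \sum_(q | r p q) (x p)^* * x q).
Proof.
move=> r_sym degM Dp0 degD; rewrite graph_form //; apply: ler_sum => p _.
have sum_ge0 : 0 <= \sum_(q | r p q) `|x p - x q| ^+ 2.
  by apply: sumr_ge0 => q _; rewrite exprn_ge0.
have deg_ge0 : 0 <= 2 * (M%:R - #|r p|%:R) * `|x p| ^+ 2 :> C.
  by rewrite !mulr_ge0 ?exprn_ge0 // subr_ge0 ler_nat.
case Dp: (D p).
  rewrite mulr1 -[leLHS]add0r lerD // (bigD1 p0) ?Dp0 //= lerDl.
  by apply: sumr_ge0 => q _; rewrite exprn_ge0.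
rewrite mulr0 subr0 -[leLHS]addr0 lerD // ler_peMl ?exprn_ge0 //.
rewrite -natrB // -natrM ler1n muln_gt0 /= subn_gt0 degD //.
by rewrite Dp.
Qed.

End Domination.

(** * Matrices over a C*-algebra *)

Section CStarMatrices.
Context (R : realType) (B : cstarAlgType R).
Local Notation C := R[i].
Local Open Scope sesquilinear_scope.

(** [mxstar] for rectangular matrices. *)
Definition mxadj m n (X : 'M[as_ring B]_(m, n)) : 'M[as_ring B]_(n, m) :=
  map_mx (@star R B) X^T.

Lemma star0 : star (0 : B) = 0.
Proof. by rewrite -{1}(scale0r (0 : B)) starZ conjC0 scale0r. Qed.

Lemma star1 : star (cone : B) = cone.
Proof.
have e : cmul (star cone) (cone : B) = star cone by rewrite cmulr1.
by rewrite -[RHS]starK -[X in _ = star X]e starM starK cmulr1.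
Qed.

Lemma star_sum (J : Type) (r : seq J) (P : pred J) (F : J -> as_ring B) :
  star (\sum_(j <- r | P j) F j : B) =
  (\sum_(j <- r | P j) (star (F j) : as_ring B) : B).
Proof. by apply: (big_morph (@star R B)); [exact: starD|exact: star0]. Qed.

Lemma mxadjM m n p (X : 'M[as_ring B]_(m, n)) (Y : 'M[as_ring B]_(n, p)) :
  mxadj (X *m Y) = mxadj Y *m mxadj X.
Proof.
apply/matrixP => i j; rewrite !mxE star_sum; apply: eq_bigr => k _.
by rewrite !mxE; exact: starM.
Qed.

Lemma mxadjK m n (X : 'M[as_ring B]_(m, n)) : mxadj (mxadj X) = X.
Proof. by apply/matrixP => i j; rewrite !mxE starK. Qed.

Lemma mxadj0 m n : mxadj (0 : 'M[as_ring B]_(m, n)) = 0.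
Proof. by apply/matrixP => i j; rewrite !mxE; exact: star0. Qed.

Lemma mxadj_block m1 m2 n1 n2 (a : 'M[as_ring B]_(m1, n1))
    (b : 'M[as_ring B]_(m1, n2)) (c : 'M[as_ring B]_(m2, n1))
    (d : 'M[as_ring B]_(m2, n2)) :
  mxadj (block_mx a b c d) = block_mx (mxadj a) (mxadj c) (mxadj b) (mxadj d).
Proof. by rewrite /mxadj tr_block_mx map_block_mx. Qed.

Lemma mxadj_col m1 m2 n (a : 'M[as_ring B]_(m1, n)) (b : 'M[as_ring B]_(m2, n)) :
  mxadj (col_mx a b) = row_mx (mxadj a) (mxadj b).
Proof. by rewrite /mxadj tr_col_mx map_row_mx. Qed.

(** [mxpositive] asks for a square factor; zero rows and columns make room for a
    rectangular one. *)
Lemma gram_pad m n (Z : 'M[as_ring B]_(m, n)) :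
  mxpositive (block_mx (mxadj Z *m Z) 0 0 0 : 'M[as_ring B]_(n + m)).
Proof.
exists (block_mx 0 0 Z 0).
rewrite -[mxstar _]/(mxadj _) mxadj_block mulmx_block !mxadj0.
by rewrite !mul0mx !mulmx0 !addr0 add0r.
Qed.

Lemma gramD m1 m2 n (Y : 'M[as_ring B]_(m1, n)) (Z : 'M[as_ring B]_(m2, n)) :
  mxadj Y *m Y + mxadj Z *m Z = mxadj (col_mx Y Z) *m col_mx Y Z.
Proof. by rewrite mxadj_col mul_row_col. Qed.

Definition scalar_mat m n (a : 'M[C]_(m, n)) :
  'M[as_ring B]_(m, n) := map_mx (fun z => z *: (cone : B)) a.

Lemma mul_scale_cone (z : C) (x : B) :
  cmul (z *: cone) x = z *: x.
Proof. by rewrite cmulZl cmul1l. Qed.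

Lemma mul_cone_scale (z : C) (x : B) :
  cmul x (z *: cone) = z *: x.
Proof. by rewrite cmulZr cmulr1. Qed.

Lemma mxadj_scalar m n (a : 'M[C]_(m, n)) :
  mxadj (scalar_mat a) = scalar_mat (a^t*).
Proof. by apply/matrixP => i j; rewrite !mxE starZ star1. Qed.

End CStarMatrices.

Arguments scalar_mat {R} B {m n} a.


(** * Matrices over M_N(C) as complex matrices *)

Section Flattening.
Context (R : realType) (I : finType).
Local Notation C := R[i].
Local Notation A := (bop R I).
Local Notation N := #|I|.
Local Open Scope sesquilinear_scope.

Definition entry (T : A) (k l : 'I_N) : C := (T : 'M[C]_N) k l.

Lemma entry_sum (J : Type) (r : seq J) (P : pred J) (F : J -> as_ring A) k l :
  entry (\sum_(j <- r | P j) F j) k l = \sum_(j <- r | P j) entry (F j) k l.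
Proof.
apply: (big_morph (fun T : as_ring A => entry T k l)) => [S T|];
by rewrite /entry mxE.
Qed.

Lemma entry_mul (S T : as_ring A) k l :
  entry (S * T) k l = \sum_j entry S k j * entry T j l.
Proof. by rewrite /entry mxE. Qed.

Lemma entry_star (T : A) k l : entry (star T) k l = (entry T l k)^*.
Proof. by rewrite /entry !mxE. Qed.

(** The *-isomorphism from M_n(M_N(C)) to M_(nN)(C), with the rows indexed by
    pairs. *)
Definition flat m n (X : 'M[as_ring A]_(m, n)) :
    'M[C]_(#|{: 'I_m * 'I_N}|, #|{: 'I_n * 'I_N}|) :=
  \matrix_(p, q) entry (X (enum_val p).1 (enum_val q).1)
                       (enum_val p).2 (enum_val q).2.

Definition unflat m n (M : 'M[C]_(#|{: 'I_m * 'I_N}|, #|{: 'I_n * 'I_N}|)) :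
    'M[as_ring A]_(m, n) :=
  \matrix_(i, j) ((\matrix_(k, l) M (enum_rank (i, k)) (enum_rank (j, l))) : A).

Lemma unflatK m n : cancel (@unflat m n) (@flat m n).
Proof.
move=> M; apply/matrixP => p q.
by rewrite !mxE /entry !mxE -!surjective_pairing !enum_valK.
Qed.

Lemma flatK m n : cancel (@flat m n) (@unflat m n).
Proof.
move=> X; apply/matrixP => i j; apply/matrixP => k l.
by rewrite !mxE !enum_rankK.
Qed.

Lemma sum_pairs m (F : 'I_#|{: 'I_m * 'I_N}| -> C) :
  \sum_p F p = \sum_i \sum_k F (enum_rank (i, k)).
Proof.
rewrite pair_bigA (reindex (@enum_rank ('I_m * 'I_N)%type)) /=.
  by apply: eq_bigr => -[].
by exists (@enum_val _ _) => p _; rewrite ?enum_rankK ?enum_valK.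
Qed.

Lemma flatM m n p (X : 'M[as_ring A]_(m, n)) (Y : 'M[as_ring A]_(n, p)) :
  flat (X *m Y) = flat X *m flat Y.
Proof.
apply/matrixP => i j; rewrite !mxE entry_sum sum_pairs.
apply: eq_bigr => k _; rewrite entry_mul; apply: eq_bigr => l _.
by rewrite !mxE !enum_rankK.
Qed.

Lemma flatD m n (X Y : 'M[as_ring A]_(m, n)) : flat (X + Y) = flat X + flat Y.
Proof. by apply/matrixP => i j; rewrite !mxE /entry mxE. Qed.

Lemma flat_adj m n (X : 'M[as_ring A]_(m, n)) : flat (mxadj X) = (flat X)^t*.
Proof. by apply/matrixP => i j; rewrite !mxE entry_star. Qed.

(** Positivity in M_n(M_N(C)) is positivity of a quadratic form; the square root
    of the flattened matrix provides the factor. *)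
Lemma mxpositiveP n (X : 'M[as_ring A]_n) : mxpositive X <-> psd (flat X).
Proof.
split=> [[Y ->]|/psd_sqrt[Y eY]].
  by rewrite flatM flat_adj; exact: psd_gram.
exists (unflat Y); apply: (can_inj (@flatK n n)).
by rewrite flatM flat_adj unflatK.
Qed.

Lemma gram_mxpositive m n (X : 'M[as_ring A]_(m, n)) :
  mxpositive (mxadj X *m X).
Proof. by apply/mxpositiveP; rewrite flatM flat_adj; exact: psd_gram. Qed.

End Flattening.

(** * Completely positive maps *)
Section CompletelyPositiveMaps.
Context (R : realType) (I : finType) (B : cstarAlgType R).
Local Notation C := R[i].
Local Notation A := (bop R I).
Local Open Scope sesquilinear_scope.
Context (phi : A -> B) (phi_cp : completely_positive setT phi).

Definition amplify m n (X : 'M[as_ring A]_(m, n)) : 'M[as_ring B]_(m, n) :=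
  map_mx phi X.

Lemma cp_lin (a : C) (x y : A) : phi (a *: x + y) = a *: phi x + phi y.
Proof. exact: phi_cp.1. Qed.

Lemma cpD (x y : A) : phi (x + y) = phi x + phi y.
Proof. by rewrite -[x in LHS]scale1r cp_lin scale1r. Qed.

Lemma cp0 : phi 0 = 0.
Proof. by apply: (addrI (phi 0)); rewrite -cpD !addr0. Qed.

Lemma cpZ (a : C) (x : A) : phi (a *: x) = a *: phi x.
Proof. by rewrite -[_ *: x]addr0 cp_lin cp0 addr0. Qed.

Lemma cp_sum (J : Type) (r : seq J) (P : pred J) (F : J -> as_ring A) :
  phi (\sum_(j <- r | P j) F j) = (\sum_(j <- r | P j) (phi (F j) : as_ring B) : B).
Proof. by apply: (big_morph phi); [exact: cpD|exact: cp0]. Qed.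

Lemma amplifyD m n (X Y : 'M[as_ring A]_(m, n)) :
  amplify (X + Y) = amplify X + amplify Y.
Proof. by apply/matrixP => i j; rewrite !mxE; exact: cpD. Qed.

Lemma amplify0 m n : amplify (0 : 'M[as_ring A]_(m, n)) = 0.
Proof. by apply/matrixP => i j; rewrite !mxE; exact: cp0. Qed.

Lemma amplify_positive n (X : 'M[as_ring A]_n) :
  mxpositive X -> mxpositive (amplify X).
Proof. by apply: phi_cp.2. Qed.

(** The matrix with rows (1, x) and (x^*, x^* x) is a square, so its image is
    hermitian; compare the off-diagonal entries. *)
Lemma cp_star (x : A) : phi (star x) = star (phi x).
Proof.
pose v : 'M[as_ring A]_(1, 2) := \row_j (if j == 0 then cone else x).
have [W eW] := amplify_positive (gram_mxpositive v).
have /matrixP/(_ 1 0) : mxadj (amplify (mxadj v *m v)) = amplify (mxadj v *m v).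
  by rewrite eW -[mxstar W]/(mxadj W) mxadjM mxadjK.
rewrite !mxE !big_ord_recl !big_ord0 !mxE /= !addr0.
rewrite -[GRing.mul]/(@cmul R A) star1.
by rewrite cmul1l cmulr1.
Qed.

Lemma amplify_scalar_mul m n p (a : 'M[C]_(m, n)) (X : 'M[as_ring A]_(n, p)) :
  amplify (scalar_mat A a *m X) = scalar_mat B a *m amplify X.
Proof.
apply/matrixP => i j; rewrite !mxE cp_sum; apply: eq_bigr => k _; rewrite !mxE.
rewrite -[GRing.mul]/(@cmul R A) -[RHS]/(cmul _ _) !mul_scale_cone; exact: cpZ.
Qed.

Lemma amplify_mul_scalar m n p (X : 'M[as_ring A]_(m, n)) (a : 'M[C]_(n, p)) :
  amplify (X *m scalar_mat A a) = amplify X *m scalar_mat B a.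
Proof.
apply/matrixP => i j; rewrite !mxE cp_sum; apply: eq_bigr => k _; rewrite !mxE.
rewrite -[GRing.mul]/(@cmul R A) -[RHS]/(cmul _ _) !mul_cone_scale; exact: cpZ.
Qed.

End CompletelyPositiveMaps.

(** * Toeplitz operators over a finite set of integers *)

Section ToeplitzRigidity.
Context (R : realType) (I : finType) (c : 'I_#|I| -> int).
Context (c_inj : injective c) (i0 : 'I_#|I|).
Local Notation C := R[i].
Local Notation A := (bop R I).
Local Notation N := #|I|.
Local Open Scope sesquilinear_scope.

Definition toep : set A :=
  [set T | exists t : int -> C, forall k l, entry T k l = t (c k - c l)].

Lemma toep0 : toep 0.
Proof. by exists (fun=> 0) => k l; rewrite /entry mxE. Qed.

(** A finite set of integers is not invariant under a nonzero translation: take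
    its largest or smallest element. *)
Lemma no_invariant_shift (m : int) : m != 0 ->
  exists j, forall l, c l != c j + m.
Proof.
case: (ltgtP m 0) => // m0 _.
  case: (@Order.TotalTheory.arg_minP _ int _ i0 xpredT c isT) => j _ jP.
  exists j => l; apply/eqP => e; have := jP l isT; rewrite e => h.
  by move: m0 h; lia.
case: (@Order.TotalTheory.arg_maxP _ int _ i0 xpredT c isT) => j _ jP.
exists j => l; apply/eqP => e; have := jP l isT; rewrite e => h.
by move: m0 h; lia.
Qed.

Local Notation pair := ('I_#|{: 'I_N * 'I_N}|).
Let fst (p : pair) : 'I_N := (enum_val p).1.
Let snd (p : pair) : 'I_N := (enum_val p).2.

(* The pairs (i, k) and (j, l) are joined when the shift that maps i to k maps
   j to l. *)
Let same_shift : rel pair :=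
  fun p q => c (snd p) - c (snd q) == c (fst p) - c (fst q).

Lemma same_shift_inj p : {in [set q in same_shift p] &, injective fst}.
Proof.
move=> q q'; rewrite !inE => /eqP e /eqP e' eqf.
suff: enum_val q = enum_val q' by exact: enum_val_inj.
rewrite [LHS]surjective_pairing [RHS]surjective_pairing; congr (_, _) => //.
apply: c_inj; move: e e'; rewrite -[(enum_val q).2]/(snd q) -[(enum_val q').2]/(snd q') eqf.
lia.
Qed.

Lemma card_same_shift p : (#|same_shift p| <= N)%N.
Proof.
rewrite -cardsE -(card_in_imset (@same_shift_inj p)).
by rewrite (leq_trans (max_card _)) // card_ord.
Qed.

(** The indices j at which the shift by c(k) - c(i) stays inside the set are all
    N of them only for the zero shift. *)
Lemma card_same_shift_lt p : fst p != snd p -> (#|same_shift p| < N)%N.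
Proof.
move=> p_off; have [|j jP] := @no_invariant_shift (c (snd p) - c (fst p)).
  by rewrite subr_eq0; apply: contraNneq p_off => /c_inj ->.
rewrite -cardsE -(card_in_imset (@same_shift_inj p)).
suff: (#|fst @: [set q in same_shift p]| < #|[set: 'I_N]%SET|)%N.
  by rewrite cardsT card_ord.
apply/proper_card/properP; split; first exact: finset.subsetT.
exists j => //; apply/imsetP => -[q]; rewrite inE => /eqP e jq.
by have /eqP := jP (snd q); apply; rewrite jq; lia.
Qed.

(** The vector sum_i e_i (x) e_i. *)
Definition omega : 'cV[C]_#|{: 'I_N * 'I_N}| :=
  \col_p ((enum_val p).1 == (enum_val p).2)%:R.

(** In M_N(A) this is the matrix with (i, j) entry N delta_ij - S_(c(i) - c(j)),
    where S_m is the shift by m; its entries are Toeplitz. *)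
Definition shift_laplacian : 'M[C]_#|{: 'I_N * 'I_N}| :=
  \matrix_(p, q) (N%:R *+ (p == q) - (same_shift p q)%:R).

Lemma qform_shift_laplacian v : qform shift_laplacian v =
  N%:R * \sum_p `|v p 0| ^+ 2 -
  \sum_p \sum_(q | same_shift p q) (v p 0)^* * v q 0.
Proof.
rewrite qformE mulr_sumr -sumrB; apply: eq_bigr => p _.
under eq_bigr do rewrite mxE mulrBr mulrBl.
rewrite sumrB; congr (_ - _).
  rewrite (bigD1 p) //= eqxx big1 ?addr0 => [|q qp].
    by rewrite mulr1n normCK; ring.
  by rewrite eq_sym (negbTE qp) mulr0n mulr0 mul0r.
rewrite [RHS]big_mkcond; apply: eq_bigr => q _.
by case: (same_shift p q); rewrite ?(mulr1, mulr0, mul0r).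
Qed.

(** Pairs with i <> k have degree smaller than N, and the pairs (i, i) are all
    joined to each other, so the form controls everything off the line of
    [omega]. *)
Lemma shift_laplacian_ge (v : 'cV[C]_#|{: 'I_N * 'I_N}|) :
  \sum_p `|v p 0 - v (enum_rank (i0, i0)) 0 * omega p 0| ^+ 2 <=
  2 * qform shift_laplacian v.
Proof.
rewrite qform_shift_laplacian.
under eq_bigr => p _ do rewrite mxE.
apply: (@graph_form_ge _ _ same_shift N (fun p => fst p == snd p)
  (enum_rank (i0, i0)) (fun p => v p 0)).
- by move=> p q; rewrite /same_shift; apply/eqP/eqP; lia.
- exact: card_same_shift.
- by move=> p /eqP e; rewrite /same_shift -e /fst /snd enum_rankK.
- by move=> p /card_same_shift_lt.
Qed.

Lemma qform_shift_laplacian_omega : qform shift_laplacian omega = 0.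
Proof.
rewrite qform_shift_laplacian mulr_sumr -sumrB big1 // => p _.
rewrite mxE; have [pd|pd] := eqVneq (enum_val p).1 (enum_val p).2; last first.
  rewrite normr0 expr0n mulr0 sub0r big1 ?oppr0 // => q _.
  by rewrite conjC0 mul0r.
rewrite normr1 expr1n mulr1 conjC1.
under eq_bigr do rewrite mul1r mxE.
rewrite (eq_bigl (fun q => fst q == snd q)) => [|q]; last first.
  rewrite /same_shift /fst /snd pd.
  by apply/eqP/eqP => [e|->]; [apply: c_inj; lia|lia].
under eq_bigr => q qd do rewrite qd.
rewrite big_mkcond sum_pairs /=; apply/eqP; rewrite subr_eq0; apply/eqP.
transitivity (\sum_(i < N) (1 : C)); first by rewrite sumr_const card_ord.
apply: eq_bigr => i _; rewrite (bigD1 i) //= /fst /snd enum_rankK eqxx.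
by rewrite big1 ?addr0 // => j ji; rewrite enum_rankK /= eq_sym (negbTE ji).
Qed.

End ToeplitzRigidity.

(** * Rigidity of the Toeplitz system *)

Section Rigidity.
Context (R : realType) (I : finType) (c : 'I_#|I| -> int).
Context (c_inj : injective c) (i0 : 'I_#|I|).
Local Notation C := R[i].
Local Notation A := (bop R I).
Local Notation N := #|I|.
Local Open Scope sesquilinear_scope.
Context (B : cstarAlgType R) (phi : A -> B).
Context (phi_cp : completely_positive setT phi).
Context (phi_reflect : forall n (X : 'M[as_ring A]_n),
  (forall i j, toep c (X i j)) -> mxpositive (amplify phi X) -> mxpositive X).

(** A rectangular factor, as produced by stacking several squares, is enough for
    reflection: pad X and its factor with zeros to a common size. *)
Lemma gram_reflect m n (X : 'M[as_ring A]_n) (Y : 'M[as_ring B]_(m, n)) :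
    (forall i j, toep c (X i j)) -> amplify phi X = mxadj Y *m Y ->
  psd (flat X).
Proof.
move=> tX eX; pose W : 'M[as_ring A]_(n + m) := block_mx X 0 0 0.
have [||U eU] := @phi_reflect _ W.
- move=> i j; rewrite /W mxE; case: fintype.split => i'; rewrite mxE; case: fintype.split => j';
    rewrite ?mxE; [exact: tX|exact: toep0..].
- by rewrite /amplify /W map_block_mx -!/(amplify phi _) eX !(amplify0 phi_cp); exact: gram_pad.
have -> : X = mxadj (lsubmx U) *m lsubmx U.
  rewrite -[X](block_mxKul _ 0 0 (0 : 'M[as_ring A]_m)) -/W eU.
  rewrite -{1 2}[U]hsubmxK /mxstar tr_row_mx map_col_mx mul_col_row.
  by rewrite block_mxKul.
exact/mxpositiveP/gram_mxpositive.
Qed.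

Lemma toep_unflat (a b : C) i j :
  toep c (unflat (a%:M + b *: @shift_laplacian R I c) i j).
Proof.
exists (fun m => a *+ ((i == j) && (m == 0)) + b * (N%:R *+ ((i == j) && (m == 0)) -
  (m == c i - c j)%:R)) => k l.
rewrite /entry !mxE !enum_rankK /=.
have -> : (enum_rank (i, k) == enum_rank (j, l)) = (i == j) && (c k - c l == 0).
  by rewrite (inj_eq enum_rank_inj) xpair_eqE subr_eq0 (inj_eq c_inj).
by [].
Qed.

Lemma omega_gt0 : 0 < qform 1%:M (omega R I).
Proof.
rewrite qform1 (bigD1 (enum_rank (i0, i0))) //= mxE enum_rankK eqxx normr1 expr1n.
by rewrite ltr_pwDl // sumr_ge0 // => p _; rewrite exprn_ge0.
Qed.

(** Every vector u of C^n (x) C^N is the image of [omega] under a scalar matrix,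
    whose entries are those of u. *)
Lemma flat_scalar_omega n (u : 'cV[C]_#|{: 'I_n * 'I_N}|) :
  flat (scalar_mat A (\matrix_(i, j) u (enum_rank (i, j)) 0)) *m omega R I = u.
Proof.
apply/colP => p; rewrite -[p]enum_valK; case: (enum_val p) => i k {p}.
rewrite mxE sum_pairs.
have E j l : flat (scalar_mat A (\matrix_(i, j) u (enum_rank (i, j)) 0))
    (enum_rank (i, k)) (enum_rank (j, l)) * omega R I (enum_rank (j, l)) 0 =
    u (enum_rank (i, j)) 0 * (k == l)%:R * (j == l)%:R.
  by rewrite !mxE !enum_rankK /entry !mxE.
rewrite (bigD1 k) //= (bigD1 k) //= E !eqxx !mulr1 big1 ?addr0 => [|l lk].
  rewrite big1 ?addr0 // => j jk; rewrite big1 // => l _; rewrite E.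
  case: (eqVneq k l) => [<-|_]; first by rewrite (negbTE jk) mulr0.
  by rewrite mulr0 mul0r.
by rewrite E eq_sym (negbTE lk) !mulr0.
Qed.

(** The main step: the Toeplitz matrix T dominates the compression X' of X and
    takes at [omega] a value that exceeds <u, X u> by as little as desired. *)
Lemma hermitian_reflect m n (X : 'M[as_ring A]_n) (Y : 'M[as_ring B]_(m, n)) :
    mxadj X = X -> amplify phi X = mxadj Y *m Y -> psd (flat X).
Proof.
move=> hX eX u; pose al := \matrix_(i, j) u (enum_rank (i, j)) 0.
pose X' := mxadj (scalar_mat A al) *m X *m scalar_mat A al.
set s := qform (flat X) u.
have sE : qform (flat X') (omega R I) = s.
  by rewrite /X' !flatM flat_adj qform_mul flat_scalar_omega.
have s_real : s \is Num.real.
  by apply/CrealP; rewrite /s -qform_adj -flat_adj hX.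
rewrite real_leNgt ?real0 //; apply/negP => s_lt0.
(* If s < 0, this margin keeps s + e negative. *)
pose e := - s / 2; have e_gt0 : 0 < e by rewrite divr_gt0 ?ltr0n // oppr_gt0.
pose k := qform 1%:M (omega R I); have k_gt0 : 0 < k by exact: omega_gt0.
pose a := (s + e) / k.
have a_real : a^* = a.
  apply/CrealP; rewrite rpredM ?rpredV ?rpredD //; exact: gtr0_real.
have qa : qform a%:M (omega R I) = s + e.
  by rewrite -scalemx1 qformZ -/k divfK // gt_eqF.
pose P := a%:M - flat X'.
have hX' : mxadj X' = X' by rewrite /X' !mxadjM mxadjK hX mulmxA.
have hP : P^t* = P.
  rewrite /P ctrmxD -scaleN1r ctrmxZ conjCN1 scaleN1r -flat_adj.
  by rewrite hX' tr_scalar_mx map_scalar_mx /= a_real scaleN1r.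
have qP : qform P (omega R I) = e by rewrite qformD qformN qa sE addrAC subrr add0r.
have [|t t_ge0 tP] := @qform_dominate _ _ P (omega R I) (enum_rank (i0, i0)) hP.
  by rewrite qP.
pose L := @shift_laplacian R I c.
pose W := unflat (P + (t * 2) *: L) : 'M[as_ring A]_N.
have W_ge0 : mxpositive W.
  apply/mxpositiveP => x; rewrite unflatK qformD qformZ (le_trans (tP x)) //.
  by rewrite lerD2l -mulrA ler_wpM2l // shift_laplacian_ge.
(* T = X' + W, so phi(T) is a sum of two squares. *)
pose T := unflat (a%:M + (t * 2) *: L) : 'M[as_ring A]_N.
have TE : T = X' + W.
  by apply: (can_inj (@flatK R I _ _)); rewrite flatD !unflatK /P addrCA addrA subrK.
have [V eV] := amplify_positive phi_cp W_ge0.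
have : psd (flat T).
  apply: (@gram_reflect _ _ T (col_mx (Y *m scalar_mat B al) V)).
    by move=> i j; exact: toep_unflat.
  rewrite TE (amplifyD phi_cp) eV -gramD mxadjM /X' mxadj_scalar.
  rewrite (amplify_mul_scalar phi_cp) (amplify_scalar_mul phi_cp) eX.
  by rewrite mxadj_scalar !mulmxA.
move=> /(_ (omega R I)); rewrite unflatK qformD qformZ.
rewrite (qform_shift_laplacian_omega R c_inj) mulr0 addr0 qa.
have -> : s + e = - e by rewrite /e; field.
by rewrite oppr_ge0 => /(lt_le_trans e_gt0); rewrite ltxx.
Qed.

(** If phi(X) is positive then phi vanishes on X - X^*; the multiples of
    X - X^* by 'i and - 'i are then hermitian with image 0, hence positive, so X
    is hermitian. *)
Lemma amplify_reflect n (X : 'M[as_ring A]_n) :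
  mxpositive (amplify phi X) -> mxpositive X.
Proof.
move=> [Y eY]; apply/mxpositiveP; apply: (hermitian_reflect (Y := Y)) => //.
have phiX i j : phi (star (X j i)) = phi (X i j).
  rewrite (cp_star phi_cp).
  have /matrixP/(_ i j) : mxadj (amplify phi X) = amplify phi X.
    by rewrite eY -[mxstar Y]/(mxadj Y) mxadjM mxadjK.
  by rewrite !mxE.
have null (K : 'M[as_ring A]_n) : mxadj K = K -> amplify phi K = 0 -> psd (flat K).
  move=> hK K0; apply: (hermitian_reflect (Y := 0 : 'M[as_ring B]_n) hK).
  by rewrite K0 mulmx0.
pose D := flat X - (flat X)^t*.
have D_ge0 (z : C) : z^* = - z -> psd (z *: D).
  move=> zN; pose H := unflat (z *: D) : 'M[as_ring A]_n.
  rewrite -[z *: D]unflatK -/H; apply: null.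
    by apply: (can_inj (@flatK R I _ _)); rewrite flat_adj unflatK skew_part_hermitian.
  apply/matrixP => i j; rewrite !mxE.
  have -> : (\matrix_(k, l) (z *: D) (enum_rank (i, k)) (enum_rank (j, l)) : A) =
      z *: (X i j - star (X j i)).
    by apply/matrixP => k l; rewrite !mxE !enum_rankK.
  rewrite (cpZ phi_cp) -scaleN1r (cpD phi_cp) (cpZ phi_cp) phiX scaleN1r subrr.
  exact: scaler0.
have D0 : D = 0.
  apply: qform_eq0 => v; apply: (mulfI (neq0Ci C)); rewrite mulr0.
  have h1 := D_ge0 'i (conjCi _) v; have h2 := D_ge0 (- 'i) _ v.
  apply/eqP; rewrite eq_le -qformZ h1 andbT -oppr_ge0 -qformN -scaleNr h2 //.
  by rewrite rmorphN /= conjCi.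
apply: (can_inj (@flatK R I _ _)); rewrite flat_adj.
by apply/eqP; rewrite eq_sym -subr_eq0 -/D D0.
Qed.

(** Both z and - z, as 1 x 1 matrices, have image 0 and so are positive. *)
Lemma cp_kernel (z : A) : phi z = 0 -> z = 0.
Proof.
move=> z0; pose Z (a : C) : 'M[as_ring A]_1 := const_mx (a *: z).
have Z_entry a p q : flat (Z a) p q =
    a * entry z (enum_val p).2 (enum_val q).2.
  by rewrite [LHS]mxE [X in entry X]mxE /entry mxE.
have Z_ge0 a : psd (flat (Z a)).
  apply/mxpositiveP/amplify_reflect; exists 0; rewrite mulmx0.
  by apply/matrixP => i j; rewrite !mxE (cpZ phi_cp) z0 scaler0.
have Z0 : flat (Z 1) = 0.
  apply: qform_eq0 => v; apply/eqP; rewrite eq_le Z_ge0 andbT -oppr_ge0 -qformN.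
  have -> : - flat (Z 1) = flat (Z (-1)); last exact: Z_ge0.
  by apply/matrixP => p q; rewrite [LHS]mxE !Z_entry mul1r mulN1r.
apply/matrixP => k l; rewrite [RHS]mxE -[LHS]/(entry z k l).
have /matrixP/(_ (enum_rank (0, k)) (enum_rank (0, l))) := Z0.
by rewrite Z_entry !enum_rankK mul1r mxE.
Qed.

Lemma cp_injective (x y : A) : phi x = phi y -> x = y.
Proof.
move=> exy; apply/eqP; rewrite -subr_eq0; apply/eqP/cp_kernel.
by rewrite -scaleN1r (cpD phi_cp) (cpZ phi_cp) exy scaleN1r subrr.
Qed.

Theorem toeplitz_rigidity : complete_order_injection setT phi.
Proof.
split=> // [x y _ _|n X _]; [exact: cp_injective|exact: amplify_reflect].
Qed.

End Rigidity.

(** * Products of Toeplitz operators *)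

Section PowerSpan.
Context (R : realType) (B : cstarAlgType R) (F : set B) (n : nat).
Local Notation C := R[i].

Lemma power_span0 : power_span F n 0.
Proof. by exists 0%N, (fun=> 0), (fun=> fun=> 0); split=> [[]//|]; rewrite big_ord0. Qed.

Lemma power_span_lin (a : C) (x y : B) :
  power_span F n x -> power_span F n y -> power_span F n (a *: x + y).
Proof.
move=> [m1 [c1 [f1 [F1 ->]]]] [m2 [c2 [f2 [F2 ->]]]].
pose sel (T : Type) (g1 : 'I_m1 -> T) (g2 : 'I_m2 -> T) (j : 'I_(m1 + m2)) :=
  match fintype.split j with inl i => g1 i | inr i => g2 i end.
have selL T g1 g2 i : @sel T g1 g2 (lshift m2 i) = g1 i.
  by rewrite /sel -[lshift _ _]/(unsplit (inl _)) unsplitK.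
have selR T g1 g2 i : @sel T g1 g2 (rshift m1 i) = g2 i.
  by rewrite /sel -[rshift _ _]/(unsplit (inr _)) unsplitK.
exists (m1 + m2)%N, (sel _ (fun i => a * c1 i) c2), (sel _ f1 f2); split.
  by move=> j i; rewrite /sel; case: fintype.split => k; [exact: F1|exact: F2].
rewrite big_split_ord scaler_sumr; congr (_ + _); apply: eq_bigr => j _.
  by rewrite !selL scalerA.
by rewrite !selR.
Qed.

Lemma power_span_sum (J : Type) (r : seq J) (P : pred J) (a : J -> C) (x : J -> B) :
  (forall j, P j -> power_span F n (x j)) ->
  power_span F n (\sum_(j <- r | P j) a j *: x j).
Proof.
move=> Fx; elim/big_rec: _ => [|j y Pj Fy]; first exact: power_span0.
by apply: power_span_lin => //; exact: Fx.
Qed.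

Lemma cstar_subalgebra_setT : cstar_subalgebra [set: B].
Proof. by split=> //; exact: closedT. Qed.

End PowerSpan.

Section PowerSpanLow.
Context (R : realType) (B : cstarAlgType R) (F : set B).
Local Notation C := R[i].

Lemma power_span2 (x y : B) : F x -> F y -> power_span F 2 (cmul x y).
Proof.
move=> Fx Fy; exists 1%N, (fun=> 1), (fun _ (i : 'I_2) => if i == 0 then x else y).
split=> [_ i|]; first by case: ifP.
by rewrite big_ord1 scale1r !big_ord_recl big_ord0 /= mulr1.
Qed.

Lemma power_span1 (x : B) : F x -> power_span F 1 x.
Proof.
move=> Fx; exists 1%N, (fun=> 1), (fun _ _ => x); split=> // .
by rewrite big_ord1 scale1r big_ord1.
Qed.

Lemma power_span1_sub : F 0 ->
  (forall (a : C) x y, F x -> F y -> F (a *: x + y)) -> power_span F 1 `<=` F.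
Proof.
move=> F0 Flin x [m [c [f [Ff ->]]]]; elim/big_rec: _ => [|j y _ Fy] //.
by apply: Flin => //; rewrite big_ord1; exact: Ff.
Qed.

End PowerSpanLow.

Section ToeplitzProducts.
Context (R : realType) (I : finType) (c : 'I_#|I| -> int).
Context (c_inj : injective c) (i0 : 'I_#|I|).
Local Notation C := R[i].
Local Notation A := (bop R I).
Local Notation N := #|I|.

Definition shift_op (m : int) : A := (\matrix_(k, l) (c k - c l == m)%:R : 'M[C]_N).

Lemma toep_shift_op m : toep c (shift_op m).
Proof. by exists (fun p => (p == m)%:R) => k l; rewrite /entry mxE. Qed.

Lemma toep_lin (a : C) (x y : A) : toep c x -> toep c y -> toep c (a *: x + y).
Proof.
move=> [s xs] [t yt]; exists (fun m => a * s m + t m) => k l.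
by rewrite -xs -yt /entry !mxE.
Qed.

(** A product of two shifts is the composed shift, cut off where the
    intermediate point leaves the set. *)
Lemma shift_op_mul (m p : int) x y :
  entry (cmul (shift_op m) (shift_op p)) x y =
  ((c x - c y == m + p) && [exists j, c j == c y + p])%:R.
Proof.
rewrite [LHS](@entry_mul R I (shift_op m) (shift_op p)).
under eq_bigr do rewrite /entry !mxE -natrM mulnb.
case: existsP => [[j /eqP jP]|no_j]; last first.
  rewrite andbF big1 // => j _.
  case: eqP => //= _; case: eqP => //= e; case: no_j; exists j; apply/eqP; lia.
rewrite andbT (bigD1 j) //= big1 ?addr0 => [|l lj].
  congr (_%:R); congr nat_of_bool; rewrite jP.
  by apply/andP/eqP => [[/eqP ? _]|?]; [lia|split; apply/eqP; lia].
have -> : c l - c y == p = false.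
  by apply: contra_neqF lj => /eqP e; apply: c_inj; lia.
by rewrite andbF.
Qed.

(** Translating so that l lands on the largest element M removes from the
    product all points above l; the points below l are handled by induction on
    their number. *)
Lemma delta_in_square k l :
  power_span (@toep R I c) 2 (delta_mx k l : 'M[C]_N).
Proof.
have [n] := ubnP #|[pred y | c y < c l]|; elim: n k l => // n IHn k l le_n.
case: (@Order.TotalTheory.arg_maxP _ int _ i0 xpredT c isT) => M _ cM.
pose U := cmul (shift_op (c k - c M)) (shift_op (c M - c l)).
pose P (q : 'I_N * 'I_N) := (c q.1 - c q.2 == c k - c l) &&
  [exists j, c j == c q.2 + (c M - c l)].
have UE : U = (\sum_(q | P q) 1 *: (delta_mx q.1 q.2 : A) : A).
  apply/matrixP => x y; rewrite -[LHS]/(entry U x y) shift_op_mul.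
  rewrite -[RHS]/(entry _ x y) entry_sum.
  have -> : c k - c M + (c M - c l) = c k - c l by lia.
  rewrite -/(P (x, y)) big_mkcond (bigD1 (x, y)) //= big1 ?addr0 => [|q qxy].
    by case: (P _) => //; rewrite scale1r /entry mxE !eqxx.
  case: (P q) => //; rewrite scale1r /entry mxE.
  by case: eqP => [ex|//]; case: eqP => [ey|//]; move: qxy; rewrite ex ey -surjective_pairing eqxx.
have Pkl : P (k, l).
  by rewrite /P eqxx /=; apply/existsP; exists M; apply/eqP; lia.
have -> : (delta_mx k l : 'M[C]_N) =
    (-1) *: (\sum_(q | P q && (q != (k, l))) 1 *: (delta_mx q.1 q.2 : A) : A) + U.
  rewrite UE (bigD1 (k, l) Pkl) /= [1 *: delta_mx k l]scale1r.
  by rewrite addrCA scaleN1r addNr addr0.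
apply: power_span_lin; last by apply: power_span2; exact: toep_shift_op.
apply: power_span_sum => q /andP[/andP[/eqP eq1 /existsP[j /eqP jP]] qkl].
have lt_q : c q.2 < c l.
  have jM : c j <= c M := cM j isT.
  have ne : c q.2 != c l.
    apply: contraNneq qkl => e; rewrite [q]surjective_pairing; apply/eqP.
    congr (_, _); apply: c_inj => //. 
    by move: eq1; rewrite e => /addIr.
  rewrite lt_neqAle ne /= -(lerD2r (c M - c l)) -jP.
  by rewrite addrC subrK.
apply: IHn; rewrite -ltnS (leq_trans _ le_n) // ltnS; apply: proper_card.
apply/properP; split.
  by apply/fintype.subsetP => y; rewrite !inE => /lt_trans; apply.
by exists q.2; rewrite !inE // ltxx.
Qed.

Lemma toep_square_full : power_span (@toep R I c) 2 = [set: A].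
Proof.
apply/seteqP; split=> // T _; rewrite [T : A](matrix_sum_delta (T : 'M[C]_N)).
rewrite pair_bigA; apply: (@power_span_sum R A (@toep R I c) 2 _ _ _ (fun q => (T : 'M[C]_N) q.1 q.2)).
by move=> q _; exact: delta_in_square.
Qed.

(** If S_m S_(-m) were Toeplitz its diagonal would be constant.  It is 1 at j,
    and 0 at a point x for which c(x) - m is not a value of c. *)
Lemma toep_not_subalgebra (j : 'I_N) : j != i0 ->
  ~ cstar_subalgebra (power_span (@toep R I c) 1).
Proof.
move=> ji [_ _ mul_closed _ _]; set m := c j - c i0.
have m_neq0 : - m != 0 by rewrite oppr_eq0 subr_eq0 (inj_eq c_inj).
have := mul_closed _ _ (power_span1 (toep_shift_op m)) (power_span1 (toep_shift_op (- m))).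
move/(power_span1_sub (toep0 _ _) toep_lin) => [t tP].
have [x xP] := no_invariant_shift c i0 m_neq0.
have := tP x x; rewrite subrr -(subrr (c j)) -tP !shift_op_mul !subrr eqxx /=.
have -> : [exists y, c y == c x - m] = false.
  by apply/negbTE/existsPn => y; exact: xP.
have -> : [exists y, c y == c j - m].
  by apply/existsP; exists i0; rewrite /m; apply/eqP; lia.
by move/eqP; rewrite eq_sym oner_eq0.
Qed.

Lemma toep_generates : cstar_generated (@toep R I c) = [set: A].
Proof.
apply/seteqP; split=> // T _ F [F0 Flin Fmul _ _] sF.
have : power_span (@toep R I c) 2 T by rewrite toep_square_full.
move=> [m [a [f [tf ->]]]]; elim/big_rec: _ => [|j y _ Fy] //.
apply: Flin => //; rewrite !big_ord_recl big_ord0 mulr1.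
by apply: Fmul; apply: sF; exact: tf.
Qed.

End ToeplitzProducts.

(** * Coding lattice points by integers *)

Section FreimanCode.
Context (d N : nat) (pos : 'I_N -> 'rV[int]_d).

Lemma int_nonroot (p : {poly int}) : p != 0 -> exists z : int, ~~ root p z.
Proof.
move=> p0; apply: contrapT => all_root.
have : all (root p) (map Posz (iota 0 (size p))).
  apply/allP => z _; apply: contrapT => /negP nz; apply: all_root; by exists z.
move=> /(max_poly_roots p0); rewrite map_inj_uniq ?iota_uniq; last by move=> ? ? [].
by move=> /(_ isT); rewrite size_map size_iota ltnn.
Qed.

(** The code is k |-> P_k(z), where P_k is the polynomial whose coefficients are
    the coordinates of pos k, and z is an integer at which none of the nonzero
    polynomials P_k - P_l - (P_k' - P_l') vanishes. *)
Lemma difference_code : exists c : 'I_N -> int, forall k l k' l',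
  (c k - c l == c k' - c l') = (pos k - pos l == pos k' - pos l').
Proof.
pose D (q : ('I_N * 'I_N) * ('I_N * 'I_N)) : 'rV[int]_d :=
  pos q.1.1 - pos q.1.2 - (pos q.2.1 - pos q.2.2).
pose p : {poly int} := \prod_(q | D q != 0) rVpoly (D q).
have [|z] := @int_nonroot p.
  apply/prodf_neq0 => q Dq; apply: contra Dq => /eqP e.
  by rewrite -[D q]rVpolyK e linear0.
rewrite /root horner_prod => /prodf_neq0 z_gen.
exists (fun k => (rVpoly (pos k)).[z]) => k l k' l'.
rewrite -[LHS]subr_eq0 -[RHS]subr_eq0.
have -> : (rVpoly (pos k)).[z] - (rVpoly (pos l)).[z] -
    ((rVpoly (pos k')).[z] - (rVpoly (pos l')).[z]) =
    (rVpoly (D ((k, l), (k', l')))).[z].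
  by rewrite /D !linearB /= !(hornerD, hornerN); ring.
apply/idP/eqP => [e|e]; last by rewrite /D /= e linear0 horner0.
by apply/eqP; apply: contraTT e => nz; exact: (z_gen ((k, l), (k', l')) nz).
Qed.

End FreimanCode.

Section ToeplitzClasses.
Context (R : realType) (I : finType).
Local Notation C := R[i].

Lemma difference_functionP (V : zmodType) (pos : 'I_#|I| -> V) (T : bop R I) :
  (exists t : V -> C, forall k l, entry T k l = t (pos k - pos l)) <->
  (forall k l k' l', pos k - pos l = pos k' - pos l' ->
     entry T k l = entry T k' l').
Proof.
split=> [[t tP] k l k' l' e|TP]; first by rewrite !tP e.
pose t m : C :=
  if [pick q | pos q.1 - pos q.2 == m] is Some q then entry T q.1 q.2 else 0.
exists t => k l; rewrite /t; case: pickP => [q /eqP e|/(_ (k, l))].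
  exact: TP.
by rewrite eqxx.
Qed.

Lemma toep_codeP d (pos : 'I_#|I| -> 'rV[int]_d) (c : 'I_#|I| -> int)
    (T : bop R I) :
    (forall k l k' l',
       (c k - c l == c k' - c l') = (pos k - pos l == pos k' - pos l')) ->
  toep c T <->
  exists t : 'rV[int]_d -> C, forall k l, entry T k l = t (pos k - pos l).
Proof.
move=> code; rewrite /toep /= !difference_functionP.
by split=> TP k l k' l' /eqP e; apply/TP/eqP; rewrite ?code // -code.
Qed.

End ToeplitzClasses.

Section Code.
Context (d N : nat) (pos : 'I_N -> 'rV[int]_d) (c : 'I_N -> int).

Lemma code_injective : injective pos ->
    (forall k l k' l', (c k - c l == c k' - c l') = (pos k - pos l == pos k' - pos l')) ->
  injective c.
Proof.
move=> pos_inj code k l ckl; apply/pos_inj/eqP; rewrite -subr_eq0 -(subrr (pos l)) -code.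
by rewrite ckl !subrr.
Qed.

End Code.

(** * Means and derivatives of trigonometric polynomials *)

Section CosineWaves.
Context (R : realType).
Local Notation mu := (@lebesgue_measure R).

Lemma cos_2piZ (x : R) (m : int) : cos (x + m%:~R * (2 * pi)) = cos x.
Proof.
have e : 2 * pi = pi *+ 2 :> R by rewrite mulr_natl.
case: m => n; rewrite e.
  by rewrite -pmulrn mulr_natl (periodicn (@cosD2pi R)).
rewrite NegzE mulrNz mulNr -pmulrn mulr_natl.
by rewrite -(periodicn (@cosD2pi R) n.+1) subrK.
Qed.

Lemma is_derive_wave (a k h x : R) :
  is_derive x 1 (fun t => a * cos (k * t + h)) (- (a * k * sin (k * x + h))).
Proof.
have daff : is_derive x 1 (fun t : R => k * t + h) k.
  have h1 := @is_deriveD R _ _ _ _ x 1 _ _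
    (@is_deriveZ R _ _ id k x 1 1 (is_derive_id x 1)) (is_derive_cst h x 1).
  by apply: is_derive_eq h1 _; rewrite addr0; exact: mulr1.
have dcos := @is_derive1_comp R (@cos R) (fun t => k * t + h) x _ _
  (is_derive_cos (k * x + h)) daff.
pose F t : R := a * cos (k * t + h).
change (is_derive x 1 F (- (a * k * sin (k * x + h)))).
apply: is_derive_eq (@is_deriveZ R _ _ _ a x 1 _ dcos) _.
by rewrite -[_ *: _]/(_ * _); ring.
Qed.

Lemma wave_continuous (k h : R) : continuous (fun t => cos (k * t + h)).
Proof.
move=> t; apply: continuous_comp; last exact: continuous_cos.
apply: cvgD; last exact: cvg_cst.
by apply: cvgM; [exact: cvg_cst|exact: cvg_id].
Qed.

(** For m <> 0, cos (m t + h) has the antiderivative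
    cos (m t + h - pi / 2) / m, of period 2 pi. *)
Lemma mean_wave (m : int) (h : R) :
  (2 * pi)^-1 * \int[mu]_(t in `[0, 2 * pi]) cos (m%:~R * t + h) =
  if m == 0 then cos h else 0.
Proof.
have pi2_gt0 : 0 < 2 * pi :> R by rewrite mulr_gt0 // pi_gt0.
have [->|m0] := eqVneq m 0.
  under eq_Rintegral do rewrite mul0r add0r.
  rewrite Rintegral_cst //.
  have -> : fine (mu `[0, 2 * pi]%classic) = 2 * pi.
    have e := @lebesgue_measure_itv R `[0, 2 * pi].
    by apply: etrans (congr1 fine e) _; rewrite /= lte_fin pi2_gt0 /= subr0.
  by rewrite mulrCA mulVf ?mulr1 // gt_eqF.
have mR0 : m%:~R != 0 :> R by rewrite intr_eq0.
pose F t : R := (m%:~R)^-1 * cos (m%:~R * t + (h - pi / 2)).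
have dF (x : R) : is_derive x 1 F (cos (m%:~R * x + h)).
  apply: is_derive_eq (is_derive_wave _ _ _ _) _.
  rewrite addrA mulVf // sinD cosN sinN cos_pihalf sin_pihalf; ring.
have cF (x : R) : F y @[y --> x] --> F x.
  by apply/differentiable_continuous/derivable1_diffP; exact: ex_derive.
have F_per : F (2 * pi) = F 0.
  by rewrite /F mulr0 add0r addrC cos_2piZ.
rewrite /Rintegral (@continuous_FTC2 _ _ F) //=.
- by rewrite F_per subrr mulr0.
- by apply: continuous_subspaceT; exact: wave_continuous.
- split=> [x _||]; first exact: ex_derive.
  + exact/cvg_at_right_filter/cF.
  + exact/cvg_at_left_filter/cF.
- by move=> x _; rewrite derive1E; exact: derive_val.
Qed.

End CosineWaves.

Section TrigonometricPolynomials.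
Context (R : realType).
Local Notation C := R[i].
Local Notation mu := (@lebesgue_measure R).

Definition dot d (n : 'rV[int]_d) (x : 'rV[R]_d) : R :=
  \sum_i (n 0 i)%:~R * x 0 i.

(** Real trigonometric polynomials with phases, listed as (amplitude, frequency,
    phase).  With phases the class is closed under partial derivatives and under
    fixing one coordinate, so cosines alone suffice. *)
Definition trig d (s : seq (R * 'rV[int]_d * R)) (x : 'rV[R]_d) : R :=
  \sum_(h <- s) h.1.1 * cos (dot h.1.2 x + h.2).

Lemma continuous_bigsum (T : topologicalType) (J : Type) (r : seq J) (P : pred J)
    (f : J -> T -> R) :
  (forall j, continuous (f j)) -> continuous (fun x => \sum_(j <- r | P j) f j x).
Proof.
move=> cf x; elim: r => [|j r IHr].
  by under eq_fun do rewrite big_nil; exact: cvg_cst.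
under eq_fun do rewrite big_cons.
by case: (P j) => //; apply: cvgD => //; exact: cf.
Qed.

Lemma continuous_scale (T : topologicalType) (f : T -> R) (a : R) :
  continuous f -> continuous (fun x => a * f x).
Proof. by move=> cf x; apply: cvgM; [exact: cvg_cst|exact: cf]. Qed.

Lemma continuous_cos_shift (T : topologicalType) (f : T -> R) (a : R) :
  continuous f -> continuous (fun x => cos (f x + a)).
Proof.
move=> cf x; have ca : {for x, continuous (fun y => f y + a)}.
  by apply: cvgD; [exact: cf|exact: cvg_cst].
exact: (continuous_comp ca (@continuous_cos R _)).
Qed.

Lemma integrable_wave (a k h : R) :
  mu.-integrable `[0, 2 * pi] (EFin \o (fun t => a * cos (k * t + h))).
Proof.
apply: continuous_compact_integrable; first exact: segment_compact.
apply: continuous_subspaceT => t; apply: cvgM; first exact: cvg_cst.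
exact: wave_continuous.
Qed.

Lemma mean_scaled_wave (a h : R) (m : int) :
  (2 * pi)^-1 * \int[mu]_(t in `[0, 2 * pi]) (a * cos (m%:~R * t + h)) =
  if m == 0 then a * cos h else 0.
Proof.
have -> : \int[mu]_(t in `[0, 2 * pi]) (a * cos (m%:~R * t + h)) =
    a * \int[mu]_(t in `[0, 2 * pi]) cos (m%:~R * t + h).
  apply: RintegralZl => //; have := integrable_wave 1 m%:~R h.
  by apply: eq_integrable => // t _ /=; rewrite mul1r.
transitivity (a * ((2 * pi)^-1 * \int[mu]_(t in `[0, 2 * pi]) cos (m%:~R * t + h))).
  by rewrite mulrA [_ * a]mulrC -mulrA.
by rewrite mean_wave; case: eqP => // _; rewrite mulr0.
Qed.

Lemma mean_waves (J : Type) (r : seq J) (P : pred J) (a h : J -> R) (m : J -> int) :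
  (2 * pi)^-1 * \int[mu]_(t in `[0, 2 * pi])
    (\sum_(j <- r | P j) a j * cos ((m j)%:~R * t + h j)) =
  \sum_(j <- r | P j && (m j == 0)) a j * cos (h j).
Proof.
elim: r => [|j r IHr].
  under eq_Rintegral do rewrite big_nil.
  by rewrite Rintegral_cst // mul0r mulr0 big_nil.
under eq_Rintegral do rewrite big_cons.
rewrite big_cons; case: (P j) => //=.
have -> : \int[mu]_(t in `[0, 2 * pi]) (a j * cos ((m j)%:~R * t + h j) +
      \sum_(i <- r | P i) a i * cos ((m i)%:~R * t + h i)) =
    \int[mu]_(t in `[0, 2 * pi]) (a j * cos ((m j)%:~R * t + h j)) +
    \int[mu]_(t in `[0, 2 * pi]) (\sum_(i <- r | P i) a i * cos ((m i)%:~R * t + h i)).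
  apply: RintegralD => //; first exact: integrable_wave.
  apply: continuous_compact_integrable; first exact: segment_compact.
  apply: continuous_subspaceT; apply: continuous_bigsum => i t.
  apply: cvgM; first exact: cvg_cst.
  exact: wave_continuous.
rewrite mulrDr IHr mean_scaled_wave.
by case: eqP => _ //; rewrite add0r.
Qed.

(** Fixing the first coordinate t moves its contribution into the phase; the
    inner mean keeps the waves whose other frequencies vanish, and the outer
    integral those for which the first one does too. *)
Lemma torus_mean_trig d (s : seq (R * 'rV[int]_d * R)) :
  torus_mean (trig s) = \sum_(h <- s | h.1.2 == 0) h.1.1 * cos h.2.
Proof.
elim: d s => [|d IHd] s.
  rewrite /= /trig; apply: eq_big => [h|h _].
    by apply/esym/eqP/rowP => -[].
  by rewrite /dot big_ord0 add0r.
pose slice t (h : R * 'rV[int]_d.+1 * R) : R * 'rV[int]_d * R :=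
  (h.1.1, \row_i h.1.2 0 (lift ord0 i), (h.1.2 0 ord0)%:~R * t + h.2).
have slice_trig t : (fun x : 'rV[R]_d => trig s (row_mx t%:M x : 'rV[R]_(1 + d))) =
    trig (map (slice t) s).
  apply/funext => x; rewrite /trig big_map; apply: eq_bigr => h _ /=.
  congr (_ * cos _); rewrite [in RHS]addrA; congr (_ + _).
  rewrite /dot big_ord_recl [RHS]addrC; congr (_ + _).
    congr (_ * _); have := @row_mxEl _ 1 1 d t%:M x 0 ord0.
    by rewrite [X in _ = X]mxE eqxx mulr1n => e; rewrite -[RHS]e; congr (row_mx _ _ _ _); apply: val_inj.
  apply: eq_bigr => i _; rewrite mxE; congr (_ * _).
  rewrite -[RHS](@row_mxEr _ 1 1 d t%:M x 0 i).
  by congr (row_mx _ _ _ _); apply: val_inj.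
rewrite /=; under eq_Rintegral do rewrite slice_trig IHd big_map /slice /=.
rewrite mean_waves; apply: eq_bigl => h /=.
apply/andP/eqP => [[/eqP t0 /eqP h0]|->]; last first.
  by split; [apply/eqP/rowP => i|]; rewrite !mxE.
apply/rowP => i; rewrite mxE; case: (unliftP ord0 i) => [j ->|->] //.
by have /rowP/(_ j) := t0; rewrite !mxE.
Qed.

(** Directional derivatives depend only on the restriction of f to a line. *)
Lemma is_derive_line d (f : 'rV[R]_d -> R) (x v : 'rV[R]_d) (df : R) :
  is_derive (0 : R) 1 (fun t : R => f (t *: v + x)) df -> is_derive x v f df.
Proof.
move=> [].
rewrite /derivable /derive.
have -> : (fun h => h^-1 *: (((fun t => f (t *: v + x)) \o shift 0) (h *: 1) -
   f (0 *: v + x))) = (fun h : R => h^-1 *: ((f \o shift x) (h *: v) - f x)).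
  apply/funext => h /=; rewrite scale0r add0r addr0; congr (_ *: (f (_ *: v + x) - _)).
  exact: mulr1.
by move=> ? ?; split.
Qed.

Lemma is_derive_trig d (s : seq (R * 'rV[int]_d * R)) (x : 'rV[R]_d) (i : 'I_d) :
  is_derive x 'e_i (trig s)
    (trig (map (fun h => (h.1.1 * ((h.1.2 : 'rV[int]_d) 0 i)%:~R, h.1.2, h.2 + pi / 2)) s) x).
Proof.
apply: is_derive_line.
have e (t : R) : trig s (t *: 'e_i + x) =
    \sum_(h <- s) h.1.1 * cos (((h.1.2 : 'rV[int]_d) 0 i)%:~R * t + (dot h.1.2 x + h.2)).
  apply: eq_bigr => h _; congr (_ * cos _); rewrite addrA; congr (_ + _).
  rewrite /dot (bigD1 i) //= [in RHS](bigD1 i) //= !mxE !eqxx mulr1 mulrDr -addrA.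
  congr (_ + (_ + _)); apply: eq_bigr => j ji.
  by rewrite !mxE eqxx (negbTE ji) mulr0 add0r.
have -> : (fun t : R => trig s (t *: 'e_i + x)) = (fun t =>
    \sum_(h <- s) h.1.1 * cos (((h.1.2 : 'rV[int]_d) 0 i)%:~R * t + (dot h.1.2 x + h.2))).
  exact/funext.
rewrite /trig big_map; elim: s {e} => [|h s IHs].
  rewrite big_nil; under eq_fun do rewrite big_nil.
  exact: is_derive_cst.
rewrite big_cons; under eq_fun do rewrite big_cons.
apply: is_deriveD.
apply: is_derive_eq (is_derive_wave _ _ _ _) _.
rewrite mulr0 add0r /= addrA [in RHS]cosD cos_pihalf sin_pihalf.
by ring.
Qed.

Lemma trig_continuous d (s : seq (R * 'rV[int]_d * R)) : continuous (trig s).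
Proof.
apply: continuous_bigsum => h; apply: continuous_scale.
have cdot : continuous (dot h.1.2 : 'rV[R]_d -> R).
  apply: continuous_bigsum => i; apply: continuous_scale.
  exact: coord_continuous.
exact: continuous_cos_shift.
Qed.

Lemma trig_smooth d (s : seq (R * 'rV[int]_d * R)) : smooth (trig s).
Proof.
move=> l; have [s' ->] : exists s', iter_partial l (trig s) = trig s'.
  elim: l => [|i l [s' e]]; first by exists s.
  rewrite /= e; eexists; apply/funext => x; exact: (@derive_val _ _ _ _ _ _ _ (is_derive_trig s' x i)).
split; first exact: trig_continuous.
by move=> i x; exact: (@ex_derive _ _ _ _ _ _ _ (is_derive_trig s' x i)).
Qed.

End TrigonometricPolynomials.

(** * The truncated system as a Toeplitz system *)

Section Characters.
Context (R : realType) (d : nat).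
Local Notation C := R[i].
Implicit Types (m n : 'rV[int]_d) (x : 'rV[R]_d).

Lemma dotDl m n x : dot (m + n) x = dot m x + dot n x.
Proof.
by rewrite /dot -big_split; apply: eq_bigr => i _; rewrite mxE intrD mulrDl.
Qed.

Lemma dotNl n x : dot (- n) x = - dot n x.
Proof.
by rewrite /dot -sumrN; apply: eq_bigr => i _; rewrite mxE mulrNz mulNr.
Qed.

Lemma expiE n x : expi n x = (cos (dot n x) +i* sin (dot n x))%C.
Proof. by []. Qed.

Lemma expiD m n x : expi (m + n) x = expi m x * expi n x.
Proof.
rewrite !expiE dotDl cosD sinD; apply/eqP; rewrite eq_complex /=.
by apply/andP; split; apply/eqP; ring.
Qed.

Lemma conj_expi n x : (expi n x)^* = expi (- n) x.
Proof.
by rewrite !expiE dotNl cosN sinN.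
Qed.

(** The sine is handled as a cosine shifted by a quarter period. *)
Lemma expi_periodic n (k : 'rV[int]_d) x :
  expi n (x + (2 * pi) *: map_mx intr k) = expi n x.
Proof.
pose z : int := \sum_i n 0 i * k 0 i.
have e : dot n (x + (2 * pi) *: map_mx intr k) = dot n x + z%:~R * (2 * pi).
  rewrite /dot /z raddf_sum mulr_suml -big_split; apply: eq_bigr => i _ /=.
  by rewrite !mxE intrM; ring.
rewrite !expiE e cos_2piZ; congr (_ +i* _)%C.
rewrite -[LHS]cosBpihalf -[RHS]cosBpihalf.
by rewrite addrAC cos_2piZ.
Qed.

Definition trigC (s : seq ('rV[int]_d * C)) (x : 'rV[R]_d) : C :=
  \sum_(h <- s) h.2 * expi h.1 x.

Definition re_waves (s : seq ('rV[int]_d * C)) : seq (R * 'rV[int]_d * R) :=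
  [seq (complex.Re h.2, h.1, 0) | h <- s] ++
  [seq (complex.Im h.2, h.1, pi / 2) | h <- s].

Definition im_waves (s : seq ('rV[int]_d * C)) : seq (R * 'rV[int]_d * R) :=
  [seq (complex.Im h.2, h.1, 0) | h <- s] ++
  [seq (complex.Re h.2, h.1, - (pi / 2)) | h <- s].

Lemma Re_trigC s x : complex.Re (trigC s x) = trig (re_waves s) x.
Proof.
rewrite /trigC (raddf_sum (@complex.Re R)) /trig big_cat !big_map /= -big_split.
apply: eq_bigr => -[n [a b]] _ /=; rewrite -/(dot n x) addr0 cosD cos_pihalf sin_pihalf; ring.
Qed.

Lemma Im_trigC s x : complex.Im (trigC s x) = trig (im_waves s) x.
Proof.
rewrite /trigC (raddf_sum (@complex.Im R)) /trig big_cat !big_map /= -big_split.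
by apply: eq_bigr => -[n [a b]] _ /=; rewrite -/(dot n x) addr0 cosBpihalf; ring.
Qed.

Lemma trigC_smooth s : torus_smooth (trigC s).
Proof.
split=> [k x||].
- by apply: eq_bigr => h _; rewrite expi_periodic.
- by under eq_fun do rewrite Re_trigC; exact: trig_smooth.
- by under eq_fun do rewrite Im_trigC; exact: trig_smooth.
Qed.

Lemma torus_meanC_trigC s : torus_meanC (trigC s) = \sum_(h <- s | h.1 == 0) h.2.
Proof.
rewrite /torus_meanC; under eq_fun do rewrite Re_trigC.
under [X in (_ +i* torus_mean X)%C]eq_fun do rewrite Im_trigC.
rewrite !torus_mean_trig !big_cat !big_map /= cos0 cosN cos_pihalf.
rewrite -!mulr_suml !mulr1 !mulr0 !addr0.
apply/eqP; rewrite eq_complex /= (raddf_sum (@complex.Re R)) (raddf_sum (@complex.Im R)).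
by rewrite !eqxx.
Qed.

End Characters.

Section TruncatedSystem.
Context (R : realType) (d : nat) (Lambda : R).
Local Notation C := R[i].
Local Notation basis := (trunc_basis d Lambda).
Local Notation ball := (lattice_ball d Lambda).
Local Notation I := 'I_#|{: trunc_basis d Lambda}|.

Definition freq (p : I) : 'rV[int]_d := val (enum_val p).1.
Definition spin (p : I) : 'I_(spin_dim d) := (enum_val p).2.

(** The factor expi (- m) is the complex conjugate of expi m. *)
Definition fourier (f : 'rV[R]_d -> C) (m : 'rV[int]_d) : C :=
  torus_meanC (fun x => f x * expi (- m) x).

(** Pointwise, the product of two basis spinors vanishes unless their spins
    agree, and is a character of the difference of their frequencies otherwise. *)
Lemma compressionE f (p q : I) : entry (compression Lambda f) p q =
  if spin p == spin q then fourier f (freq p - freq q) else 0.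
Proof.
rewrite /entry mxE /spinor_dot.
have -> : (fun x => \sum_a (basis_spinor (enum_val p) x a 0)^* *
     (f x *: basis_spinor (enum_val q) x) a 0) =
    (fun x => if spin p == spin q then f x * expi (- (freq p - freq q)) x else 0).
  apply/funext => x; rewrite (bigD1 (spin p)) //= big1 ?addr0 => [|a ap].
    rewrite !mxE /= -/(spin p) -/(spin q) !eqxx !andbT mulr1.
    case: (spin p == spin q); last by rewrite !mulr0.
    rewrite mulr1 conj_expi -[fsval (enum_val p).1]/(freq p).
    rewrite -[fsval (enum_val q).1]/(freq q) opprB expiD.
    by rewrite mulrCA (mulrC (expi (- _) x)).
  by rewrite !mxE (negbTE ap) mulr0 conjC0 mul0r.
case: eqP => // _.
rewrite (_ : (fun=> 0) = trigC [::]) ?torus_meanC_trigC ?big_nil //.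
by apply/funext => x; rewrite /trigC big_nil.
Qed.

(** A given t is realized by the trigonometric polynomial whose coefficients
    are the values of t at the finitely many differences of frequencies. *)
Lemma trunc_systemP (T : bop R basis) : trunc_system T <->
  exists t : 'rV[int]_d -> C, forall p q : I,
    entry T p q = if spin p == spin q then t (freq p - freq q) else 0.
Proof.
split=> [[f _ ->]|[t tP]]; first by exists (fourier f) => p q; exact: compressionE.
pose s := undup [seq freq p - freq q | p <- enum I, q <- enum I].
pose f := trigC [seq (m, t m) | m <- s].
exists f; first exact: trigC_smooth.
apply/matrixP => p q; rewrite -[LHS]/(entry T p q) tP -[RHS]/(entry (compression Lambda f) p q).
rewrite compressionE; case: eqP => // _; rewrite /fourier /f.
set m := freq p - freq q.
have ms : m \in s.
  by rewrite mem_undup; apply/allpairsP; exists (p, q); rewrite !mem_enum.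
have -> : (fun x => trigC [seq (n, t n) | n <- s] x * expi (- m) x) =
    trigC [seq (n - m, t n) | n <- s].
  apply/funext => x; rewrite /trigC !big_map mulr_suml; apply: eq_bigr => n _ /=.
  by rewrite expiD mulrA.
rewrite torus_meanC_trigC big_map /=.
under eq_bigl do rewrite subr_eq0.
by rewrite -big_filter (filter_pred1_uniq (undup_uniq _) ms) big_seq1.
Qed.

End TruncatedSystem.

(** * Envelope and propagation number *)

Section EnvelopeCriterion.
Context (R : realType) (A0 : cstarAlgType R) (I : finType).
Context (c : 'I_#|I| -> int) (i0 : 'I_#|I|) (E : set A0) (iota : A0 -> bop R I).
Context (c_inj : injective c) (E_system : operator_system E).
Context (iota1 : unital iota) (iota_coi : complete_order_injection E iota).
Context (iotaE : iota @` E = @toep R I c).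

Lemma toeplitz_envelope : cstar_envelope E iota.
Proof.
split=> [|B phi _ phi_cp comp_coi].
  by split=> //; rewrite iotaE (toep_generates _ c_inj i0).
apply: (toeplitz_rigidity c_inj i0 phi_cp) => n X tX phiX.
have lift i j : exists2 x, E x & iota x = X i j.
  by have : (@toep R I c) (X i j) by []; rewrite -iotaE => -[x Ex <-]; exists x.
pose X' : 'M[as_ring A0]_n := \matrix_(i, j) (projT1 (cid2 (lift i j)) : A0).
have EX' i j : E (X' i j) by rewrite mxE; case: cid2.
have XE : X = map_mx iota X' by apply/matrixP => i j; rewrite !mxE; case: cid2.
have [[_ iota_cp] _ _] := iota_coi; have [_ _ reflect] := comp_coi.
rewrite XE; apply: iota_cp => //; apply: reflect => //.
move: phiX; rewrite /amplify XE -map_mx_comp.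
by [].
Qed.

Lemma propagation_number_gt1 (j : 'I_#|I|) : j != i0 ->
  propagation_number E iota 2.
Proof.
move=> ji; split=> //; first exact: toeplitz_envelope.
  by rewrite iotaE (toep_square_full _ c_inj i0); exact: cstar_subalgebra_setT.
by case=> [|[|m]] // _; rewrite iotaE; exact: (toep_not_subalgebra c_inj ji).
Qed.

Lemma propagation_number1 : (forall j, j = i0) -> propagation_number E iota 1.
Proof.
move=> all_i0; split=> //; first exact: toeplitz_envelope.
  have full : power_span (iota @` E) 1 = [set: bop R I]; last first.
    by rewrite full; exact: cstar_subalgebra_setT.
  apply/seteqP; split=> // T _; apply: power_span1; rewrite iotaE.
  by exists (fun=> entry T i0 i0) => k l; rewrite (all_i0 k) (all_i0 l).
by case.
Qed.

End EnvelopeCriterion.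

Section TruncatedTorus.
Context (R : realType) (d : nat) (Lambda : R).
Local Notation C := R[i].
Local Notation basis := (trunc_basis d Lambda).
Local Notation ball := (lattice_ball d Lambda).
Local Notation I := 'I_#|{: trunc_basis d Lambda}|.
Local Notation J := 'I_#|{: lattice_ball d Lambda}|.
Local Notation E := (@trunc_system R d Lambda).
Local Open Scope sesquilinear_scope.

Definition ball_pos (k : J) : 'rV[int]_d := val (enum_val k).

Lemma ball_pos_inj : injective ball_pos.
Proof. by move=> k l /val_inj/enum_val_inj. Qed.

Lemma freq_spin_inj (p q : I) : freq p = freq q -> spin p = spin q -> p = q.
Proof.
move=> /val_inj e1 e2; apply: enum_val_inj.
by rewrite [LHS]surjective_pairing [RHS]surjective_pairing e1; congr (_, _).
Qed.

Definition site (k : J) : I := enum_rank (enum_val k, Ordinal (spin_dim_gt0 d)).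
Definition block (p : I) : J := enum_rank (enum_val p).1.

Lemma freq_site k : freq (site k) = ball_pos k.
Proof. by rewrite /freq enum_rankK. Qed.

Lemma spin_site k : spin (site k) = Ordinal (spin_dim_gt0 d).
Proof. by rewrite /spin enum_rankK. Qed.

Lemma site_inj : injective site.
Proof. by move=> k l /enum_rank_inj/(congr1 fst)/enum_val_inj. Qed.

Lemma ball_pos_block p : ball_pos (block p) = freq p.
Proof. by rewrite /ball_pos enum_rankK. Qed.

Lemma entry_toeplitz (T : bop R basis) k l :
  entry (toeplitz T) k l = entry T (site k) (site l).
Proof. by rewrite /entry mxE. Qed.

Lemma entry_trunc (T : bop R basis) p q : E T ->
  entry T p q = if spin p == spin q
                then entry (toeplitz T) (block p) (block q) else 0.
Proof.
move=> /trunc_systemP[t tP]; rewrite entry_toeplitz !tP !spin_site eqxx.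
by rewrite !freq_site !ball_pos_block.
Qed.

Lemma trunc_operator_system : operator_system E.
Proof.
split=> [|a x y /trunc_systemP[s sP] /trunc_systemP[t tP]|x /trunc_systemP[t tP]].
- apply/trunc_systemP; exists (fun m => (m == 0)%:R) => p q.
  rewrite /entry mxE subr_eq0; case: eqP => [->|pq].
    by rewrite !eqxx.
  case: eqP => // e2; case: eqP => // e1; case: pq; exact: freq_spin_inj.
- apply/trunc_systemP; exists (fun m => a * s m + t m) => p q.
  have -> : entry (a *: x + y) p q = a * entry x p q + entry y p q.
    by rewrite /entry !mxE.
  by rewrite sP tP; case: ifP => // _; rewrite mulr0 addr0.
- apply/trunc_systemP; exists (fun m => (t (- m))^*) => p q.
  rewrite entry_star tP eq_sym opprB; case: ifP => // _.
  exact: conjC0.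
Qed.

Lemma toeplitz_unital : unital (@toeplitz R d Lambda).
Proof.
apply/matrixP => k l; rewrite -[LHS]/(entry _ k l) entry_toeplitz /entry !mxE.
by rewrite (inj_eq site_inj).
Qed.

(** [toeplitz] is the compression to one spin component, hence on matrices it
    selects rows and columns. *)
Lemma toeplitz_cp : completely_positive E (@toeplitz R d Lambda).
Proof.
split=> [a x y _ _|n X _ /mxpositiveP X_ge0].
  by apply/matrixP => k l; rewrite !mxE.
apply/mxpositiveP.
pose f (q : 'I_#|{: 'I_n * J}|) : 'I_#|{: 'I_n * I}| :=
  enum_rank ((enum_val q).1, site (enum_val q).2).
have -> : flat (map_mx (@toeplitz R d Lambda) X : 'M[as_ring (bop R ball)]_n) =
    mxsub f f (flat X).
  by apply/matrixP => p q; rewrite [LHS]mxE [RHS]mxE [RHS]mxE !enum_rankK mxE entry_toeplitz.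
exact: psd_mxsub.
Qed.

(** T = t (x) 1_V is a direct sum of copies of t, one for each spin component
    a.  A square root Y of t gives the square roots [Z a] of the copies. *)
Lemma toeplitz_order_reflect n (X : 'M[as_ring (bop R basis)]_n) :
    (forall i j, E (X i j)) ->
    mxpositive (map_mx (@toeplitz R d Lambda) X : 'M[as_ring (bop R ball)]_n) ->
  mxpositive X.
Proof.
move=> EX /mxpositiveP/psd_sqrt[Y eY]; apply/mxpositiveP => v.
pose g (q : 'I_#|{: 'I_n * I}|) : 'I_#|{: 'I_n * J}| :=
  enum_rank ((enum_val q).1, block (enum_val q).2).
pose Z (a : 'I_(spin_dim d)) := \matrix_(r, q) (Y r (g q) *+ (spin (enum_val q).2 == a)).
have -> : flat X = \sum_a (Z a)^t* *m Z a.
  apply/matrixP => p q; rewrite summxE [LHS]mxE entry_trunc //.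
  rewrite (bigD1 (spin (enum_val p).2)) //= big1 ?addr0 => [|a ap]; last first.
    rewrite mxE big1 // => r _.
    by rewrite !mxE [_ == a]eq_sym (negbTE ap) mulr0n conjC0 mul0r.
  rewrite mxE; under eq_bigr do rewrite !mxE eqxx mulr1n.
  case: eqP => [e|ne]; last first.
    by rewrite big1 // => r _; rewrite eq_sym; case: eqP ne => // _ _; rewrite mulr0.
  under eq_bigr do rewrite -e eqxx mulr1n.
  have /matrixP/(_ (g p) (g q)) := eY; rewrite mxE !enum_rankK mxE => ->.
  by rewrite mxE; apply: eq_bigr => r _; rewrite !mxE.
rewrite (big_morph (fun M => qform M v) (fun M N => qformD M N v) (_ : _ = 0)).
  by apply: sumr_ge0 => a _; exact: psd_gram.
by rewrite /qform mulmx0 mul0mx mxE.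
Qed.

Lemma toeplitz_coi : complete_order_injection E (@toeplitz R d Lambda).
Proof.
split; [exact: toeplitz_cp| |exact: toeplitz_order_reflect].
move=> x y Ex Ey exy; apply/matrixP => p q.
by rewrite -[LHS]/(entry x p q) -[RHS]/(entry y p q) !entry_trunc // exy.
Qed.

Lemma toeplitz_image (c : J -> int) :
    (forall k l k' l', (c k - c l == c k' - c l') =
       (ball_pos k - ball_pos l == ball_pos k' - ball_pos l')) ->
  @toeplitz R d Lambda @` E = @toep R ball c.
Proof.
move=> code; apply/seteqP; split=> [_ [T /trunc_systemP[t tP] <-]|S /(toep_codeP _ code)[t tP]].
  apply/(toep_codeP _ code); exists t => k l.
  by rewrite entry_toeplitz tP !spin_site eqxx !freq_site.
pose T : bop R basis := (\matrix_(p, q) (if spin p == spin q then t (freq p - freq q) else 0) : 'M[C]_#|basis|).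
exists T; first by apply/trunc_systemP; exists t => p q; rewrite /entry mxE.
apply/matrixP => k l; rewrite -[LHS]/(entry _ k l) -[RHS]/(entry S k l) tP.
by rewrite entry_toeplitz /entry mxE !spin_site eqxx !freq_site.
Qed.

Lemma zero_in_ball : 0 <= Lambda -> (0 : 'rV[int]_d) \in ball.
Proof.
move=> L0; rewrite in_lattice_ball big1 ?sqrtr0 // => i _.
by rewrite mxE expr0n.
Qed.

Lemma unit_in_ball (i : 'I_d) : 1 <= Lambda -> (delta_mx 0 i : 'rV[int]_d) \in ball.
Proof.
move=> L1; rewrite in_lattice_ball (bigD1 i) //= big1 => [|j ji].
  by rewrite mxE !eqxx addr0 expr1n sqrtr1.
by rewrite mxE (negbTE ji) andbF expr0n.
Qed.

Lemma ball_small n : Lambda < 1 -> n \in ball -> n = 0.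
Proof.
move=> L1; rewrite in_lattice_ball => n_le; apply/rowP => i; rewrite mxE.
apply/eqP; apply: contraTT (le_lt_trans n_le L1) => ni; rewrite -leNgt.
rewrite -[leLHS]sqrtr1 ler_wsqrtr // (bigD1 i) //= -[leLHS]addr0 lerD ?sumr_ge0 //; last first.
  by move=> j _; rewrite sqr_ge0.
by rewrite expr2 -intrM ler1z -gtz0_ge1 -expr2 exprn_even_gt0.
Qed.

End TruncatedTorus.

(* For d >= 2 the elements of the operator system are t (x) 1_V with
   dim V >= 2, so they generate B(P_Lambda L^2(T^d)) (x) 1_V; this is the
   algebra that the second component identifies as the C*-envelope.  For d = 1
   one has V = C and the inclusion into B(P_Lambda H) itself is the
   C*-envelope.  For Lambda < 1 the operator system is C.1 and its propagation
   number is 1. *)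
Theorem proposition4p1 (R : realType) (d : nat) (Lambda : R)
    (hd : (0 < d)%N) (hLambda : 0 <= Lambda) :
  [/\ cstar_envelope (@trunc_system R d Lambda) (@toeplitz R d Lambda),
      d = 1%N ->
        cstar_envelope (@trunc_system R d Lambda)
          (@idfun (bop R (trunc_basis d Lambda))),
      1 <= Lambda ->
        propagation_number (@trunc_system R d Lambda) (@toeplitz R d Lambda) 2
    & Lambda < 1 ->
        propagation_number (@trunc_system R d Lambda) (@toeplitz R d Lambda) 1].
Proof.
have [c code] := difference_code (@ball_pos R d Lambda).
have c_inj := code_injective (@ball_pos_inj R d Lambda) code.
pose i0 : 'I_#|{: lattice_ball d Lambda}| := enum_rank (FSetSub (zero_in_ball d hLambda)).
have image := toeplitz_image code.
have system := @trunc_operator_system R d Lambda.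
have coi := @toeplitz_coi R d Lambda.
have unit := @toeplitz_unital R d Lambda.
split.
- exact: (toeplitz_envelope i0 c_inj system unit coi image).
- move=> d1; have spin1 (a b : 'I_(spin_dim d)) : a = b.
    by subst d; rewrite [a]ord1 [b]ord1.
  have freq_inj : injective (@freq R d Lambda).
    by move=> p q e; apply: freq_spin_inj.
  have [c' code'] := difference_code (@freq R d Lambda).
  have c'_inj := code_injective freq_inj code'.
  apply: (toeplitz_envelope (site i0) c'_inj system) => //.
    have id_mx n (X : 'M[as_ring (bop R (trunc_basis d Lambda))]_n) : map_mx idfun X = X.
      by apply/matrixP => i j; rewrite mxE.
    by split=> // [|n X _]; [split=> // n X _|]; rewrite id_mx.
  rewrite image_id; apply/seteqP; split=> T.
    move=> /trunc_systemP[t tP]; apply/(toep_codeP _ code'); exists t => p q.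
    by rewrite tP (spin1 (spin p) (spin q)) eqxx.
  move=> /(toep_codeP _ code')[t tP]; apply/trunc_systemP; exists t => p q.
  by rewrite tP (spin1 (spin p) (spin q)) eqxx.
- move=> L1; pose j : 'I_#|{: lattice_ball d Lambda}| :=
    enum_rank (FSetSub (unit_in_ball (Ordinal hd) L1)).
  apply: (propagation_number_gt1 c_inj system unit coi image (i0 := i0) (j := j)).
  rewrite (inj_eq enum_rank_inj) -val_eqE /=; apply/eqP => /rowP/(_ (Ordinal hd)).
  by rewrite !mxE !eqxx.
- move=> L1; apply: (propagation_number1 (i0 := i0) c_inj system unit coi image) => j.
  apply: enum_val_inj; apply: val_inj; rewrite enum_rankK /=.
  by apply: (ball_small L1); exact: valP.
Qed.
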